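(* Let $\mathcal{P}$ be an ADP problem and let $\mathrm{Pol}$ be a weakly monotonic, multilinear polynomial interpretation over $\Sigma^\#$. Let $\mathcal{P}=\mathcal{P}_{\ge}\uplus\mathcal{P}_{>}$ with $\mathcal{P}_>\neq\emptyset$ such that: (1) for every $\ell\to\{p_1:r_1,\dots,p_k:r_k\}^{\mathsf{true}}\in\mathcal{P}$ we have $\mathrm{Pol}(\ell)\ge\sum_{1\le j\le k}p_j\cdot\mathrm{Pol}(\flat(r_j))$; (2) for every $\ell\to\{p_1:r_1,\dots,p_k:r_k\}^m\in\mathcal{P}$ we have $\mathrm{Pol}(\ell^\#)\ge\sum_{1\le j\le k}p_j\cdot\sum_{t\trianglelefteq_\# r_j}\mathrm{Pol}(t^\#)$; (3) for every $\ell\to\{p_1:r_1,\dots,p_k:r_k\}^m\in\mathcal{P}_>$ there is $1\le j\le k$ with $\mathrm{Pol}(\ell^\#)>\sum_{t\trianglelefteq_\# r_j}\mathrm{Pol}(t^\#)$, and if $m=\mathsf{true}$ then additionally $\mathrm{Pol}(\ell)\ge\mathrm{Pol}(\flat(r_j))$. Then $\mathcal{P}$ is iAST if and only if $\mathcal{P}_\ge\cup\flat(\mathcal{P}_>)$ is iAST (i.e., $\mathrm{Proc}_{\mathtt{RP}}(\mathcal{P})=\{\mathcal{P}_\ge\cup\flat(\mathcal{P}_>)\}$ is sound and complete).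
   Context: Fix a finite signature $\Sigma=\mathcal{D}\uplus\mathcal{C}$ (defined symbols and constructors) and a set of variables $\mathcal{V}$; all left-hand sides of ADPs have root in $\mathcal{D}$. For each $f\in\mathcal{D}$ let $f^\#$ be a fresh symbol of the same arity, $\mathcal{D}^\#=\{f^\#\mid f\in\mathcal{D}\}$, $\Sigma^\#=\Sigma\uplus\mathcal{D}^\#$; elements of $\mathcal{T}(\Sigma^\#,\mathcal{V})$ are annotated terms. $\mathrm{pos}_{\Sigma'}(t)$ is the set of positions of $t$ carrying a symbol of $\Sigma'$. $\flat(t)$ removes all annotations from $t$ (applied termwise to ADPs and sets of ADPs); $t^\#$ is $t$ with its (defined) root symbol annotated and no other annotations; $\flat_{\uparrow\pi}(t)$ removes all annotations strictly above position $\pi$. $t\trianglelefteq_\# s$ means $t=\flat(s|_\pi)$ for some $\pi\in\mathrm{pos}_{\mathcal{D}^\#}(s)$; a sum $\sum_{t\trianglelefteq_\# s}$ ranges over all such positions $\pi$. A polynomial interpretation $\mathrm{Pol}$ maps each $f\in\Sigma^\#$ of arity $n$ to a polynomial $f_{\mathrm{Pol}}\in\mathbb{N}[x_1,\dots,x_n]$ and extends homomorphically to terms, yielding $\mathrm{Pol}(t)\in\mathbb{N}[\mathcal{V}]$. It is weakly monotonic if $x\ge y$ implies $f_{\mathrm{Pol}}(\dots,x,\dots)\ge f_{\mathrm{Pol}}(\dots,y,\dots)$, and multilinear if all monomials have the form $c\cdot x_1^{e_1}\cdots x_n^{e_n}$ with $c\in\mathbb{N}$, $e_i\in\{0,1\}$.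 An inequation between polynomials holds if it is true for all instantiations of its variables by natural numbers. A finite multi-distribution on $A\neq\emptyset$ is a finite multiset of pairs $(p:a)$, $0<p\le1$, $a\in A$, with probabilities summing to 1. An ADP is $\ell\to\{p_1:r_1,\dots,p_k:r_k\}^m$ with $\ell\in\mathcal{T}(\Sigma,\mathcal{V})\setminus\mathcal{V}$, $m\in\{\mathsf{true},\mathsf{false}\}$, $\{p_1:r_1,\dots,p_k:r_k\}$ a finite multi-distribution on $\mathcal{T}(\Sigma^\#,\mathcal{V})$, $\mathcal{V}(r_j)\subseteq\mathcal{V}(\ell)$. An ADP problem is a finite set $\mathcal{P}$ of ADPs. An annotated term $t$ is a $\mathcal{P}$-normal form if no subterm of $\flat(t)$ is an instance of a left-hand side of $\mathcal{P}$; $\mathtt{ANF}_{\mathcal{P}}$ is the set of annotated terms whose proper subterms are all $\mathcal{P}$-normal forms. $s\hookrightarrow_{\mathcal{P}}\{p_1:t_1,\dots,p_k:t_k\}$ holds if there are an ADP $\ell\to\{p_1:r_1,\dots,p_k:r_k\}^m\in\mathcal{P}$, a substitution $\sigma$ and $\pi\in\mathrm{pos}_{\mathcal{D}\cup\mathcal{D}^\#}(s)$ with $\flat(s|_\pi)=\ell\sigma\in\mathtt{ANF}_{\mathcal{P}}$ such that for all $j$: (pr) $t_j=s[r_j\sigma]_\pi$ if $\pi\in\mathrm{pos}_{\mathcal{D}^\#}(s)$, $m=\mathsf{true}$; (p) $t_j=\flat_{\uparrow\pi}(s[r_j\sigma]_\pi)$ if $\pi\in\mathrm{pos}_{\mathcal{D}^\#}(s)$,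 $m=\mathsf{false}$; (r) $t_j=s[\flat(r_j)\sigma]_\pi$ if $\pi\notin\mathrm{pos}_{\mathcal{D}^\#}(s)$, $m=\mathsf{true}$; (irr) $t_j=\flat_{\uparrow\pi}(s[\flat(r_j)\sigma]_\pi)$ if $\pi\notin\mathrm{pos}_{\mathcal{D}^\#}(s)$, $m=\mathsf{false}$. A $\mathcal{P}$-chain tree (CT) is $\mathfrak{T}=(V,E,L,V_P)$: (1) $(V,E)$ a (possibly infinite) directed tree, $V\neq\emptyset$, every node with finitely many children; (2) $L$ labels each node $v$ with $(p_v,t_v)\in(0,1]\times\mathcal{T}(\Sigma^\#,\mathcal{V})$, $p_v=1$ at the root; (3) $V_P$ is a set of inner nodes, $V_R$ the remaining inner nodes; (4) if $v\in V_P$ has children $w_1,\dots,w_k$ then $t_v\hookrightarrow_{\mathcal{P}}\{\frac{p_{w_1}}{p_v}:t_{w_1},\dots,\frac{p_{w_k}}{p_v}:t_{w_k}\}$ by case (pr) or (p); (5) likewise for $v\in V_R$ by case (r) or (irr); (6) every infinite path contains infinitely many nodes of $V_P$. $|\mathfrak{T}|_{\mathtt{Leaf}}$ is the sum of $p_v$ over all leaves. $\mathcal{P}$ is iAST if $|\mathfrak{T}|_{\mathtt{Leaf}}=1$ for every $\mathcal{P}$-CT. *)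

(* Defs.v *)
(* Importing mpoly after the analysis libraries fails on a notation clash. *)
From mathcomp Require Import mpoly.
From HB Require Import structures.
From mathcomp Require Import all_boot all_order all_algebra.
From mathcomp Require Import finmap multiset.
From mathcomp Require Import all_classical all_reals.
From mathcomp Require Import ereal esum.
From Stdlib Require Import Relation_Operators.

Set Implicit Arguments.
Unset Strict Implicit.
Unset Printing Implicit Defensive.

Import Order.TTheory GRing.Theory Num.Theory.
Local Open Scope mset_scope.
Local Open Scope classical_set_scope.
Local Open Scope ring_scope.

Record signature := Signature {
  dsym : finType;
  csym : finType;
  arity : dsym + csym -> nat
}.

(* Sigma^# = Sigma + D^#: [inl f] is the symbol f, [inr d] is d^#. *)
Definition asym (S : signature) : Type := ((dsym S + csym S) + dsym S)%type.

Definition base (S : signature) (f : asym S) : dsym S + csym S :=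
  match f with inl g => g | inr d => inl d end.

Definition aarity (S : signature) (f : asym S) : nat := arity (base f).

Definition defined (S : signature) : pred (asym S) :=
  fun f => if f is inl (inl _) then true else false.

Definition annotated (S : signature) : pred (asym S) :=
  fun f => if f is inr _ then true else false.

(* T(Sigma^#, X); the subset T(Sigma, X) is the predicate [plain]. *)
Inductive term (S : signature) (X : Type) : Type :=
| Var of X
| App (f : asym S) of ('I_(aarity f) -> term S X).

Arguments Var {S X} _.
Arguments App {S X} f _.

HB.instance Definition _ (S : signature) (X : Type) := gen_eqMixin (term S X).
HB.instance Definition _ (S : signature) (X : Type) :=
  gen_choiceMixin (term S X).

Section Terms.
Context {S : signature} {X : Type}.
Local Notation term := (term S X).

Fixpoint plain (t : term) : Prop :=
  match t with
  | Var _ => True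
  | App f a => ~~ annotated f /\ forall i, plain (a i)
  end.

Fixpoint vars (t : term) : set X :=
  match t with
  | Var x => [set x]
  | App f a => [set x | exists i, vars (a i) x]
  end.

Fixpoint subst (sigma : X -> term) (t : term) : term :=
  match t with
  | Var x => sigma x
  | App f a => App f (fun i => subst sigma (a i))
  end.

(* Typechecks because f and [inl (base f)] have convertible arities. *)
Fixpoint flat (t : term) : term :=
  match t with
  | Var x => Var x
  | App f a => App (inl (base f)) (fun i => flat (a i))
  end.

(* t^#; meaningful only if the root of t is in D or D^#. *)
Definition sharp (t : term) : term :=
  match t with
  | Var x => Var x
  | App f a =>
      match base f as g return ('I_(arity g) -> term) -> term with
      | inl d => fun b => App (inr d) b
      | inr c => fun b => App (inl (inr c)) b
      end (fun i => flat (a i))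
  end.

Fixpoint positions (t : term) : seq (seq nat) :=
  match t with
  | Var _ => [:: [::]]
  | App f a =>
      [::] :: flatten [seq [seq nat_of_ord i :: p | p <- positions (a i)]
                      | i <- enum 'I_(aarity f)]
  end.

(* The values of [subterm], [replace] and [flat_above] outside of
   [positions t] are junk. *)
Fixpoint subterm (t : term) (p : seq nat) {struct p} : term :=
  match p, t with
  | i :: q, App f a =>
      if (insub i : option 'I_(aarity f)) is Some j then subterm (a j) q else t
  | _, _ => t
  end.

Fixpoint replace (t : term) (p : seq nat) (u : term) {struct p} : term :=
  match p, t with
  | [::], _ => u
  | i :: q, App f a =>
      App f (fun j => if (j : nat) == i then replace (a j) q u else a j)
  | _ :: _, Var _ => t
  end.

Fixpoint flat_above (p : seq nat) (t : term) {struct p} : term :=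
  match p, t with
  | i :: q, App f a =>
      App (inl (base f))
          (fun j => if (j : nat) == i then flat_above q (a j) else a j)
  | _, _ => t
  end.

Definition root_in (A : pred (asym S)) (t : term) : bool :=
  if t is App f _ then A f else false.

Definition pos_in (A : pred (asym S)) (t : term) : seq (seq nat) :=
  [seq p <- positions t | root_in A (subterm t p)].

End Terms.

(* N[x_1, ..., x_n] is the set of integer polynomials with coefficients >= 0. *)
Record polint (S : signature) := PolInt {
  sympol : forall f : asym S, {mpoly int[aarity f]};
  sympol_ge0 : forall f m, 0 <= (sympol f)@_m
}.

Section Interpretation.
Context {S : signature} (Pol : polint S).

Definition sym_eval (f : asym S) (v : 'I_(aarity f) -> int) : int :=
  (sympol Pol f).@[v].

Definition weakly_monotonic : Prop :=
  forall (f : asym S) (v w : 'I_(aarity f) -> nat) (i : 'I_(aarity f)),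
    (forall j, j != i -> v j = w j) -> (w i <= v i)%N ->
    sym_eval (fun j => (w j)%:Z) <= sym_eval (fun j => (v j)%:Z).

Definition multilinear : Prop :=
  forall (f : asym S) m, m \in msupp (sympol Pol f) ->
    forall i : 'I_(aarity f), (m i <= 1)%N.

Context {X : Type}.

(* The value of the polynomial Pol(t) in N[X] at the instantiation alpha. *)
Fixpoint pol (alpha : X -> nat) (t : term S X) : int :=
  match t with
  | Var x => (alpha x)%:Z
  | App f a => sym_eval (fun i => pol alpha (a i))
  end.

Definition pol_annot (alpha : X -> nat) (s : term S X) : int :=
  \sum_(p <- pos_in (@annotated S) s) pol alpha (sharp (flat (subterm s p))).

End Interpretation.

Record adp (S : signature) (X : Type) (R : realType) := ADP {
  lhs : term S X;
  rhs : {mset R * term S X};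
  flag : bool
}.

Section ADPProblems.
Context {S : signature} {X : Type} {R : realType}.
Local Notation term := (term S X).
Local Notation adp := (adp S X R).

Definition mset_map (T U : choiceType) (f : T -> U) (d : {mset T}) : {mset U} :=
  seq_mset [seq f x | x <- d].

Definition is_multidist (T : choiceType) (d : {mset R * T}) : Prop :=
  (forall x, x \in d -> 0 < x.1 <= 1) /\ \sum_(x <- d) x.1 = 1.

Definition is_adp (a : adp) : Prop :=
  [/\ plain (lhs a),
      root_in (@defined S) (lhs a),
      is_multidist (rhs a) &
      forall x, x \in rhs a -> vars x.2 `<=` vars (lhs a)].

Definition adp_problem (P : set adp) : Prop :=
  finite_set P /\ forall a, P a -> is_adp a.

Definition flat_adp (a : adp) : adp :=
  ADP (flat (lhs a)) (mset_map (fun x => (x.1, flat x.2)) (rhs a)) (flag a).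

Definition normal_form (P : set adp) (t : term) : Prop :=
  forall p, p \in positions (flat t) ->
    forall a sigma, P a -> subterm (flat t) p <> subst sigma (lhs a).

Definition ANF (P : set adp) (t : term) : Prop :=
  forall p, p \in positions t -> p <> [::] -> normal_form P (subterm t p).

(* [ann] tells whether the redex position p of s is annotated, [m] is the flag
   of the ADP; the four cases are (pr), (p), (r), (irr). *)
Definition contract (ann m : bool) (s : term) (p : seq nat)
    (sigma : X -> term) (r : term) : term :=
  match ann, m with
  | true, true => replace s p (subst sigma r)
  | true, false => flat_above p (replace s p (subst sigma r))
  | false, true => replace s p (subst sigma (flat r))
  | false, false => flat_above p (replace s p (subst sigma (flat r)))
  end.

(* [step P true] is rewriting by (pr) or (p), [step P false] by (r) or (irr). *)
Definition step (P : set adp) (ann : bool) (s : term)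
    (d : {mset R * term}) : Prop :=
  exists (a : adp) (sigma : X -> term) (p : seq nat),
    [/\ P a,
        p \in pos_in (predU (@defined S) (@annotated S)) s,
        (p \in pos_in (@annotated S) s) = ann,
        flat (subterm s p) = subst sigma (lhs a) /\
        ANF P (subst sigma (lhs a)) &
        d = mset_map (fun x => (x.1, contract ann (flag a) s p sigma x.2))
                     (rhs a)].

(* [edge v] is the set of children of v; [nodesP] is V_P. *)
Record ltree := LTree {
  carrier : choiceType;
  nodes : set carrier;
  edge : carrier -> set carrier;
  prob : carrier -> R;
  label : carrier -> term;
  nodesP : set carrier
}.

Definition inner (T : ltree) : set (carrier T) :=
  [set v | nodes v /\ edge v !=set0].

Definition leaves (T : ltree) : set (carrier T) :=
  [set v | nodes v /\ edge v = set0].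

Definition is_root (T : ltree) (r : carrier T) : Prop :=
  [/\ nodes r,
      forall v, ~ edge v r &
      forall v, nodes v -> clos_refl_trans (carrier T) (@edge T) r v].

Definition is_tree (T : ltree) : Prop :=
  [/\ forall v w, @edge T v w -> nodes v /\ nodes w,
      forall u v w, @edge T u w -> edge v w -> u = v &
      exists r : carrier T, is_root r].

Definition children_dist (T : ltree) (v : carrier T) : {mset R * term} :=
  seq_mset [seq (prob w / prob v, label w) | w <- fset_set (edge v)].

Record chain_tree (P : set adp) (T : ltree) : Prop := ChainTree {
  ct_tree : is_tree T;
  ct_finite : forall v : carrier T, nodes v -> finite_set (edge v);
  ct_prob : forall v : carrier T, nodes v -> 0 < prob v <= 1;
  ct_root : forall r : carrier T, is_root r -> prob r = 1;
  ct_nodesP : @nodesP T `<=` @inner T;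
  ct_stepP : forall v : carrier T, nodesP v ->
    step P true (label v) (children_dist v);
  ct_stepR : forall v : carrier T, inner v -> ~ nodesP v ->
    step P false (label v) (children_dist v);
  ct_infinite : forall u : nat -> carrier T,
    (forall n, edge (u n) (u n.+1)) ->
    forall n, exists2 m, (n <= m)%N & nodesP (u m)
}.

Definition leaf_mass (T : ltree) : \bar R :=
  \esum_(v in @leaves T) (prob v)%:E.

Definition iAST (P : set adp) : Prop :=
  forall T : ltree, chain_tree P T -> leaf_mass T = 1%:E.

End ADPProblems.

(* Main.v *)
(* Completeness: a chain tree of the flattened problem becomes one of P by
   keeping its shape and relabelling top-down with more annotated terms.

   Soundness: let V(t) be the sum of Pol(s^#) over the annotated subterms s of
   t. Multilinearity makes contexts affine, so V is superharmonic on every chain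
   tree, and an annotated step of Pgt lowers it by at least 1 with a probability
   bounded from below. Let u(v) be the probability of never reaching a leaf
   from v. The function f = u - eps V is subharmonic, at most 1, and positive
   only where V < 1 / eps; there the strictly concave transform W = V / (1 + V)
   drops on average by a fixed eta at every Pgt node. The subtrees cut at the
   Pgt nodes are chain trees of the flattened problem, hence are left almost
   surely, so a bound f <= a W at the Pgt nodes extends to the whole tree. But
   f <= a W everywhere yields f <= a / (1 + eta) W at the Pgt nodes. Iterating,
   f <= 0; thus u <= eps V for every eps > 0, and u = 0. *)
From mathcomp Require Import mpoly.
From mathcomp Require Import all_boot all_order all_algebra.
From mathcomp Require Import finmap multiset.
From mathcomp Require Import all_classical all_reals.
From mathcomp Require Import ereal normedtype sequences esum.
From mathcomp Require Import ring lra.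
From Stdlib Require Import Relation_Operators.
(* Imported last: constructive_ereal also defines a constant [contract]. *)
Require Import Defs.

Set Implicit Arguments.
Unset Strict Implicit.
Unset Printing Implicit Defensive.

Import Order.TTheory GRing.Theory Num.Theory.
Import numFieldNormedType.Exports.
Local Open Scope mset_scope.
Local Open Scope classical_set_scope.
Local Open Scope ring_scope.

(** * Terms *)

Section Terms.
Context {S : signature} {X : Type}.
Implicit Types (t s u r : term S X) (p : seq nat) (sigma : X -> term S X).

Lemma eq_App (f : asym S) (a b : 'I_(aarity f) -> term S X) :
  a =1 b -> App f a = App f b.
Proof. by move=> /funext ->. Qed.

Lemma flat_idem t : flat (flat t) = flat t.
Proof. by elim: t => //= f a IH; apply: eq_App. Qed.

Lemma plain_flat t : plain (flat t).
Proof. by elim: t. Qed.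

Lemma flat_plain t : plain t -> flat t = t.
Proof.
elim: t => //= -[g|d] a IH [// _ plain_a].
by apply: eq_App => i; apply: IH.
Qed.

Lemma plain_subst_var sigma t x :
  plain (subst sigma t) -> vars t x -> plain (sigma x).
Proof.
elim: t => [y /= + ->//|f a IH /= [_ plain_a] [i]]; exact: IH.
Qed.

Lemma flat_subst sigma t :
  flat (subst sigma t) = subst (flat \o sigma) (flat t).
Proof. by elim: t => //= f a IH; apply: eq_App. Qed.

Lemma vars_flat t : vars (flat t) = vars t.
Proof.
elim: t => //= f a IH; apply/seteqP; split=> x [i]; exists i.
- by rewrite -IH.
- by rewrite IH.
Qed.

Lemma sharp_subst (A : pred (asym S)) sigma t : root_in A t ->
  sharp (subst sigma t) = subst (flat \o sigma) (sharp t).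
Proof.
by case: t => // -[[d|c]|d] a _ /=; apply: eq_App => i; rewrite flat_subst.
Qed.

Lemma mem_pos_in (A : pred (asym S)) t p :
  (p \in pos_in A t) = root_in A (subterm t p) && (p \in positions t).
Proof. by rewrite mem_filter. Qed.

Lemma mem_positions_cons (f : asym S) (a : 'I_(aarity f) -> term S X) i q :
  i :: q \in positions (App f a) ->
  exists2 j : 'I_(aarity f), i = j & q \in positions (a j).
Proof.
rewrite inE /= => /flattenP[s /mapP[j _ ->]] /mapP[q' q'a [-> ->]].
by exists j.
Qed.

Section Argument.
Variables (f : asym S) (a : 'I_(aarity f) -> term S X) (j : 'I_(aarity f)).

Lemma subterm_cons q : subterm (App f a) ((j : nat) :: q) = subterm (a j) q.
Proof. by rewrite /= valK. Qed.

Lemma replace_cons q u :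
  replace (App f a) ((j : nat) :: q) u =
  App f [eta a with j |-> replace (a j) q u].
Proof.
rewrite /=; apply: eq_App => k /=.
by rewrite (_ : (_ == _ :> nat) = (k == j)) //; case: eqP => [->|].
Qed.

Lemma flat_above_cons q :
  flat_above ((j : nat) :: q) (App f a) =
  App (inl (base f)) [eta a with j |-> flat_above q (a j)].
Proof.
rewrite /=; apply: (@eq_App (inl (base f))) => k /=.
by rewrite (_ : (_ == _ :> nat) = (k == j)) //; case: eqP => [->|].
Qed.

End Argument.

Lemma replace_subterm t p :
  p \in positions t -> replace t p (subterm t p) = t.
Proof.
elim: p t => [|i q IH] [y|f a]; rewrite ?inE // => /mem_positions_cons.
move=> [j -> qa]; rewrite subterm_cons replace_cons; apply: eq_App => k /=.
by case: eqP => // ->; rewrite IH.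
Qed.

Definition plug (m : bool) s p u : term S X :=
  if m then replace s p u else flat_above p (replace s p u).

Lemma contractE (ann m : bool) s p sigma r :
  contract ann m s p sigma r =
  plug m s p (subst sigma (if ann then r else flat r)).
Proof. by case: ann m => -[]. Qed.

Lemma pos_in_App (A : pred (asym S)) (f : asym S)
    (a : 'I_(aarity f) -> term S X) :
  pos_in A (App f a) =
  nseq (A f) [::] ++
  flatten [seq [seq nat_of_ord i :: p | p <- pos_in A (a i)]
          | i <- enum 'I_(aarity f)].
Proof.
rewrite {1}/pos_in /= filter_flatten -map_comp /=.
case: (A f) => /=; [congr (_ :: flatten _)|congr flatten];
  apply: eq_map => i /=; rewrite filter_map; congr map;
  by apply: eq_filter => p; rewrite /= valK.
Qed.

End Terms.

(** * Polynomial values of annotated terms *)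

Lemma sum_eta_with (I : finType) (U : Type) (V : nmodType) (F : U -> V)
    (a : I -> U) (j : I) (u : U) :
  \sum_i F ([eta a with j |-> u] i) = F u + \sum_(i | i != j) F (a i).
Proof.
rewrite (bigD1 j) //= eqxx; congr (_ + _).
by apply: eq_bigr => i /negPf ->.
Qed.

Lemma meval_affine (R : numDomainType) n (p : {mpoly R[n]}) (i : 'I_n)
    (v : 'I_n -> R) :
  (forall m, 0 <= p@_m) -> {in msupp p, forall m : 'X_{1..n}, (m i <= 1)%N} ->
  (forall j, 0 <= v j) ->
  exists A B : R, 0 <= A /\
    forall x, p.@[[eta v with i |-> x]] = A * x + B.
Proof.
move=> p0 p_i v0.
pose c (m : 'X_{1..n}) := p@_m * \prod_(j | j != i) v j ^+ m j.
have c0 m : 0 <= c m.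
  by rewrite mulr_ge0 // prodr_ge0 // => j _; apply: exprn_ge0.
exists (\sum_(m <- msupp p | m i == 1%N) c m),
  (\sum_(m <- msupp p | m i != 1%N) c m).
split=> [|x]; first exact: sumr_ge0.
have monomialE (m : 'X_{1..n}) :
    p@_m * \prod_j [eta v with i |-> x] j ^+ m j = c m * x ^+ m i.
  rewrite (bigD1 i) //= eqxx mulrCA mulrC; congr (_ * _ * _).
  by apply: eq_bigr => j /negPf ->.
rewrite mevalE; under eq_bigr do rewrite monomialE.
rewrite (bigID (fun m : 'X_{1..n} => m i == 1%N)) /= mulr_suml.
congr (_ + _); first by apply: eq_bigr => m /eqP ->.
rewrite big_seq_cond [RHS]big_seq_cond; apply: eq_bigr => m /andP[mp mi].
have -> : m i = 0%N by have := p_i m mp; case: (m i) mi => [|[]].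
by rewrite expr0 mulr1.
Qed.

Section Evaluation.
Context {S : signature} (Pol : polint S) {X : Type}.
Implicit Types (t s u r l : term S X) (p : seq nat) (sigma : X -> term S X).
Implicit Types (alpha beta : X -> nat).

Lemma pol_annot_App alpha f (a : 'I_(aarity f) -> term S X) :
  pol_annot Pol alpha (App f a) =
  sym_eval Pol (fun i => pol Pol alpha (flat (a i))) *+ annotated f +
  \sum_i pol_annot Pol alpha (a i).
Proof.
rewrite /pol_annot pos_in_App big_cat big_flatten /= big_map.
congr (_ + _).
  case: f a => [g|d] a /=; first by rewrite big_nil.
  rewrite big_seq1 mulr1n /=; congr sym_eval; apply/funext => i.
  by rewrite flat_idem.
rewrite big_enum /=; apply: eq_bigr => i _; rewrite big_map.
by apply: eq_bigr => p _; rewrite subterm_cons.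
Qed.

Lemma sym_eval_ge0 f (v : 'I_(aarity f) -> int) :
  (forall i, 0 <= v i) -> 0 <= sym_eval Pol v.
Proof.
move=> v0; rewrite /sym_eval mevalE; apply: sumr_ge0 => m _.
apply: mulr_ge0; first exact: sympol_ge0.
by apply: prodr_ge0 => i _; apply: exprn_ge0.
Qed.

Lemma pol_ge0 alpha t : 0 <= pol Pol alpha t.
Proof. by elim: t => //= f a IH; apply: sym_eval_ge0. Qed.

Lemma pol_annot_ge0 alpha t : 0 <= pol_annot Pol alpha t.
Proof. by apply: sumr_ge0 => p _; apply: pol_ge0. Qed.

Lemma pol_annot_plain alpha t : plain t -> pol_annot Pol alpha t = 0.
Proof.
elim: t => [x _|f a IH [/negPf f_plain plain_a]].
  by rewrite /pol_annot big_nil.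
rewrite pol_annot_App f_plain add0r big1 // => i _.
exact: (IH i (plain_a i)).
Qed.

Lemma pol_sharp_le_annot alpha t : root_in (@annotated S) t ->
  pol Pol alpha (sharp (flat t)) <= pol_annot Pol alpha t.
Proof.
case: t => [//|[//|d] a _]; rewrite pol_annot_App mulr1n /=.
under eq_fun do rewrite flat_idem.
by rewrite lerDl; apply: sumr_ge0 => i _; apply: pol_annot_ge0.
Qed.

Definition subst_env alpha sigma (x : X) : nat := `|pol Pol alpha (sigma x)|.

Lemma pol_subst alpha sigma t :
  pol Pol alpha (subst sigma t) = pol Pol (subst_env alpha sigma) t.
Proof.
elim: t => [x|f a IH] /=; last by congr sym_eval; apply/funext.
by rewrite abszE ger0_norm // pol_ge0.
Qed.

Lemma pol_annot_subst alpha sigma t :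
  (forall x, vars t x -> plain (sigma x)) ->
  pol_annot Pol alpha (subst sigma t) =
  pol_annot Pol (subst_env alpha (flat \o sigma)) t.
Proof.
elim: t => [x /(_ x erefl) /pol_annot_plain ->|f a IH plain_sigma] /=.
  by rewrite /pol_annot big_nil.
rewrite !pol_annot_App; congr (_ *+ _ + _); last first.
  by apply: eq_bigr => i _; apply: IH => x xa; apply: plain_sigma; exists i.
by congr sym_eval; apply/funext => i; rewrite flat_subst pol_subst.
Qed.

Hypothesis Pol_multilinear : multilinear Pol.

Lemma sym_eval_affine f (i : 'I_(aarity f)) (v : 'I_(aarity f) -> int) :
  (forall j, 0 <= v j) ->
  exists A B : int, 0 <= A /\
    forall x, sym_eval Pol [eta v with i |-> x] = A * x + B.
Proof.
apply: meval_affine; first exact: sympol_ge0.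
by move=> m /Pol_multilinear.
Qed.

Lemma pol_replace_affine alpha s p : p \in positions s ->
  exists A B : int, 0 <= A /\ forall u,
    pol Pol alpha (flat (replace s p u)) = A * pol Pol alpha (flat u) + B.
Proof.
elim: p s => [|i q IH] s.
  by exists 1, 0; split=> // u /=; rewrite mul1r addr0.
case: s => [x|f a]; rewrite ?inE // => /mem_positions_cons[j -> /IH].
move=> [A [B [A0 AB]]].
have [C [D [C0 CD]]] :=
  @sym_eval_affine (inl (base f)) j _ (fun k => pol_ge0 alpha (flat (a k))).
exists (C * A), (C * B + D); split=> [|u]; first exact: mulr_ge0.
rewrite -mulrA addrA -mulrDr -AB -CD replace_cons /=; congr sym_eval.
by apply/funext => k /=; case: eqP.
Qed.

Lemma pol_annot_replace alpha s p : p \in positions s ->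
  exists A B : int, 0 <= A /\ forall u,
    pol_annot Pol alpha (replace s p u) =
    pol_annot Pol alpha u + A * pol Pol alpha (flat u) + B.
Proof.
elim: p s => [|i q IH] s.
  by exists 0, 0; split=> // u /=; rewrite mul0r !addr0.
case: s => [x|f a]; rewrite ?inE // => /mem_positions_cons[j -> qa].
have [A [B [A0 AB]]] := IH _ qa.
have [A' [B' [A'0 AB']]] := pol_replace_affine alpha qa.
have [D [E [D0 DE]]] :=
  @sym_eval_affine f j _ (fun k => pol_ge0 alpha (flat (a k))).
exists (A + (D * A') *+ annotated f), (B +
  \sum_(k | k != j) pol_annot Pol alpha (a k) + (D * B' + E) *+ annotated f).
split=> [|u]; first by rewrite addr_ge0 ?mulrn_wge0 ?mulr_ge0.
rewrite replace_cons pol_annot_App (sum_eta_with (pol_annot Pol alpha)) AB.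
rewrite (_ : sym_eval _ _ =
    D * (A' * pol Pol alpha (flat u) + B') + E); last first.
  by rewrite -AB' -DE; congr sym_eval; apply/funext => k /=; case: eqP.
by case: (annotated f); rewrite ?mulr1n ?mulr0n; ring.
Qed.

Lemma pol_annot_flat_above_replace alpha s p : p \in positions s ->
  exists B : int, forall u,
    pol_annot Pol alpha (flat_above p (replace s p u)) =
    pol_annot Pol alpha u + B.
Proof.
elim: p s => [|i q IH] s; first by exists 0 => u; rewrite addr0.
case: s => [x|f a]; rewrite ?inE // => /mem_positions_cons[j -> /IH[B BE]].
exists (B + \sum_(k | k != j) pol_annot Pol alpha (a k)) => u.
rewrite replace_cons flat_above_cons /= eqxx pol_annot_App add0r.
rewrite (sum_eta_with (pol_annot Pol alpha)) BE addrA; congr (_ + _).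
by apply: eq_bigr => k /negPf /= ->.
Qed.

Lemma pol_annot_flat_above_le alpha s p : p \in positions s ->
  pol_annot Pol alpha (flat_above p s) <= pol_annot Pol alpha s.
Proof.
elim: p s => [//|i q IH] [x|f a]; rewrite ?inE // => /mem_positions_cons.
move=> [j -> /IH le_j]; rewrite flat_above_cons !pol_annot_App add0r.
rewrite (sum_eta_with (pol_annot Pol alpha)) [in leRHS](bigD1 j) //= addrA.
rewrite lerD2r ler_wpDl // mulrn_wge0 // sym_eval_ge0 // => k.
exact: pol_ge0.
Qed.

Lemma pol_annot_plug alpha m s p : p \in positions s ->
  exists A B : int, 0 <= A /\ forall u,
    pol_annot Pol alpha (plug m s p u) =
    pol_annot Pol alpha u + (A * pol Pol alpha (flat u)) *+ m + B.
Proof.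
case: m => ps.
  by have [A [B AB]] := pol_annot_replace alpha ps; exists A, B.
have [B BE] := pol_annot_flat_above_replace alpha ps.
by exists 0, B; split=> // u; rewrite addr0 BE.
Qed.

Lemma pol_annot_plug_subterm_le alpha m s p : p \in positions s ->
  pol_annot Pol alpha (plug m s p (subterm s p)) <= pol_annot Pol alpha s.
Proof.
move=> ps; rewrite /plug replace_subterm //.
by case: m => //; apply: pol_annot_flat_above_le.
Qed.

Lemma pol_annot_contract alpha (ann m : bool) s p sigma l :
  plain l -> root_in (@defined S) l -> p \in positions s ->
  root_in (@annotated S) (subterm s p) = ann ->
  flat (subterm s p) = subst sigma l ->
  exists beta (A B : int), [/\ 0 <= A,
    pol Pol beta (sharp l) *+ ann + (A * pol Pol beta l) *+ m + B <=
      pol_annot Pol alpha s &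
    forall r, vars r `<=` vars l ->
      pol_annot Pol alpha (contract ann m s p sigma r) =
      pol_annot Pol beta r *+ ann + (A * pol Pol beta (flat r)) *+ m + B].
Proof.
move=> plain_l root_l ps annE redexE.
have [A [B [A0 AB]]] := pol_annot_plug alpha m ps.
exists (subst_env alpha (flat \o sigma)), A, B; split=> // [|r rl].
  apply: le_trans (pol_annot_plug_subterm_le alpha m ps).
  rewrite AB -flat_idem redexE flat_subst pol_subst (flat_plain plain_l).
  rewrite !lerD2r; case: ann annE => [annE|_]; last exact: pol_annot_ge0.
  apply: le_trans (pol_sharp_le_annot alpha annE).
  by rewrite redexE (sharp_subst sigma root_l) pol_subst.
have plain_sigma x : vars r x -> plain (sigma x).
  by move/rl; apply: plain_subst_var; rewrite -redexE; apply: plain_flat.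
rewrite contractE AB flat_subst pol_subst; case: (ann).
  by rewrite pol_annot_subst.
rewrite flat_idem pol_annot_subst ?vars_flat // pol_annot_plain //.
exact: plain_flat.
Qed.

End Evaluation.

(** * Rewrite steps *)

Lemma perm_mset_map (T U : choiceType) (f : T -> U) (d : {mset T}) :
  perm_eq (mset_map f d) [seq f x | x <- d].
Proof. exact: perm_eq_seq_mset. Qed.

Lemma mset_map_id (T : choiceType) (d : {mset T}) : mset_map id d = d.
Proof. by rewrite /mset_map map_id seq_mset_id. Qed.

Lemma mset_map_comp (T U V : choiceType) (f : U -> V) (g : T -> U)
    (d : {mset T}) : mset_map f (mset_map g d) = mset_map (f \o g) d.
Proof.
by apply/eq_seq_msetP; rewrite (map_comp f g) perm_map // perm_mset_map.
Qed.

Lemma big_mset_map (V : nmodType) (T U : choiceType) (f : T -> U)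
    (d : {mset T}) (F : U -> V) :
  \sum_(y <- mset_map f d) F y = \sum_(x <- d) F (f x).
Proof. by rewrite (perm_big _ (perm_mset_map f d)) big_map. Qed.

Lemma perm_map_lift (T1 T2 U : eqType) (phi : T1 -> U) (psi : T2 -> U)
    (y0 : T2) (s1 : seq T1) (s2 : seq T2) :
  uniq s1 -> perm_eq (map phi s1) (map psi s2) ->
  exists2 g : T1 -> T2,
    perm_eq (map g s1) s2 & {in s1, forall x, phi x = psi (g x)}.
Proof.
elim: s1 s2 => [|x s1 IH] s2 /=.
  move=> _ /perm_size/esym/eqP; rewrite size_map size_eq0 => /eqP ->.
  by exists (fun=> y0).
move=> /andP[xs1 us1] ps; have /mapP[y ys2 xy] : phi x \in map psi s2.
  by rewrite -(perm_mem ps) mem_head.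
have s2E := perm_to_rem ys2.
have [g pg gE] : exists2 g : T1 -> T2,
    perm_eq (map g s1) (rem y s2) & {in s1, forall z, phi z = psi (g z)}.
  apply: IH us1 _; rewrite -(perm_cons (phi x)) (perm_trans ps) // xy.
  exact: perm_map s2E.
have neq_x z : z \in s1 -> (z == x) = false.
  by move=> zs1; apply: contraNF xs1 => /eqP <-.
exists [eta g with x |-> y].
  rewrite /= eqxx perm_sym (perm_trans s2E) // perm_cons perm_sym.
  by rewrite (_ : map _ s1 = map g s1) //; apply/eq_in_map => z /neq_x /= ->.
move=> z; rewrite inE /= => /orP[/eqP ->|zs1]; first by rewrite eqxx.
by rewrite neq_x // gE.
Qed.

Section AnnotationOrder.
Context {S : signature} {X : Type}.
Implicit Types (t s u r : term S X) (p : seq nat) (sigma : X -> term S X).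

Inductive annot_le : term S X -> term S X -> Prop :=
| AnnotLeVar x : annot_le (Var x) (Var x)
| AnnotLeApp f a b : (forall i, annot_le (a i) (b i)) ->
    annot_le (App f a) (App f b)
| AnnotLeSharp d a b : (forall i, annot_le (a i) (b i)) ->
    annot_le (App (inl (inl d)) a) (App (inr d) b).

Lemma annot_le_refl t : annot_le t t.
Proof. by elim: t => [x|f a IH]; constructor. Qed.

Lemma annot_le_eq_flat t t' : annot_le t t' -> flat t = flat t'.
Proof. by elim=> //= *; apply: eq_App. Qed.

Lemma flat_annot_le t : annot_le (flat t) t.
Proof. by elim: t => [x|[[d|c]|d] a IH] /=; constructor. Qed.

Lemma annot_le_subst sigma t t' :
  annot_le t t' -> annot_le (subst sigma t) (subst sigma t').
Proof.
by elim=> {t t'} [x|f a b _ IH|d a b _ IH] /=;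
  [exact: annot_le_refl|constructor|constructor].
Qed.

Lemma annot_le_root (A : pred (asym S)) t t' :
  (forall d, A (inl (inl d)) -> A (inr d)) ->
  annot_le t t' -> root_in A t -> root_in A t'.
Proof. by move=> Ad; case=> //= d *; apply: Ad. Qed.

Lemma annot_le_positions t t' : annot_le t t' -> positions t = positions t'.
Proof.
elim=> {t t'} [x|f a b _ IH|d a b _ IH] //=; congr (_ :: flatten _);
  by apply: eq_map => i; rewrite IH.
Qed.

Lemma annot_le_subterm p t t' :
  annot_le t t' -> annot_le (subterm t p) (subterm t' p).
Proof.
move=> tt'; elim: tt' p => {t t'} [x|f a b ab IH|d a b ab IH] [|i q] /=;
  try by constructor.
- by case: insub => [j|]; [exact: IH|constructor].
- by rewrite /aarity /=; case: insub => [j|]; [exact: IH|constructor].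
Qed.

Lemma annot_le_replace p t t' u u' :
  annot_le t t' -> annot_le u u' ->
  annot_le (replace t p u) (replace t' p u').
Proof.
move=> tt'; elim: tt' p => {t t'} [x|f a b ab IH|d a b ab IH] [|i q] //= uu';
  by constructor=> // k; case: eqP => // _; apply: IH.
Qed.

Lemma annot_le_flat_above p t t' :
  annot_le t t' -> annot_le (flat_above p t) (flat_above p t').
Proof.
move=> tt'; elim: tt' p => {t t'} [x|f a b ab IH|d a b ab IH] [|i q] //=;
  by constructor=> // k; case: eqP => // _; apply: IH.
Qed.

Lemma annot_le_contract (ann ann' m : bool) s s' p sigma r r' :
  annot_le s s' -> annot_le r r' -> (ann -> ann') ->
  annot_le (contract ann m s p sigma r) (contract ann' m s' p sigma r').
Proof.
move=> ss' rr' ann_le; rewrite !contractE.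
have : annot_le (if ann then r else flat r) (if ann' then r' else flat r').
  case: ann ann' ann_le => -[] // => [/(_ isT)//|_|_].
    by rewrite (annot_le_eq_flat rr'); apply: flat_annot_le.
  by rewrite (annot_le_eq_flat rr'); apply: annot_le_refl.
move=> /(annot_le_subst sigma) rr; rewrite /plug.
by case: m; [|apply: annot_le_flat_above]; apply: annot_le_replace.
Qed.

End AnnotationOrder.

Section Steps.
Context {S : signature} {X : Type} {R : realType}.
Implicit Types (t s u r : term S X) (p : seq nat) (sigma : X -> term S X).
Implicit Types (P Q : set (adp S X R)) (a : adp S X R).

Definition left_sides P : set (term S X) := [set lhs a | a in P].

Lemma ANF_sub P Q t : left_sides P `<=` left_sides Q -> ANF Q t -> ANF P t.
Proof.
move=> PQ nf p pt p0 q qt a sigma Pa.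
have [b Qb <-] := PQ (lhs a) (imageP _ Pa).
exact: (nf p pt p0 q qt b sigma).
Qed.

Definition adp_step P a (ann : bool) s (d : {mset R * term S X}) : Prop :=
  exists (sigma : X -> term S X) (p : seq nat),
    [/\ p \in pos_in (predU (@defined S) (@annotated S)) s,
        (p \in pos_in (@annotated S) s) = ann,
        flat (subterm s p) = subst sigma (lhs a) /\
        ANF P (subst sigma (lhs a)) &
        d = mset_map (fun x => (x.1, contract ann (flag a) s p sigma x.2))
                     (rhs a)].

Lemma stepP P ann s d :
  step P ann s d <-> exists2 a, P a & adp_step P a ann s d.
Proof.
split=> [[a [sigma [p [Pa ps annE redexE dE]]]]|[a Pa [sigma [p]]]].
  by exists a => //; exists sigma, p.
by move=> [ps annE redexE dE]; exists a, sigma, p.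
Qed.

Lemma adp_step_sub P Q a ann s d :
  left_sides Q `<=` left_sides P ->
  adp_step P a ann s d -> adp_step Q a ann s d.
Proof.
move=> QP [sigma [p [ps annE [redexE nf] dE]]]; exists sigma, p; split=> //.
by split=> //; apply: ANF_sub QP nf.
Qed.

Lemma flat_adp_lhs a : is_adp a -> lhs (flat_adp a) = lhs a.
Proof. by move=> [/flat_plain]. Qed.

Lemma adp_step_flat_adp P a s d : is_adp a ->
  adp_step P a false s d -> adp_step P (flat_adp a) false s d.
Proof.
move=> adp_a [sigma [p [ps annE redex ->]]]; exists sigma, p.
rewrite flat_adp_lhs //; split=> //.
rewrite mset_map_comp; congr mset_map; apply/funext => x /=.
by rewrite flat_idem.
Qed.

Definition adp_annot_le a a' : Prop :=
  [/\ lhs a = lhs a', flag a = flag a' &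
      exists2 h, forall r, annot_le (h r) r &
        rhs a = mset_map (fun x => (x.1, h x.2)) (rhs a')].

Lemma adp_annot_le_refl a : adp_annot_le a a.
Proof.
split=> //; exists id; first exact: annot_le_refl.
by rewrite (_ : (fun x => _) = id) ?mset_map_id //; apply/funext => -[].
Qed.

Lemma flat_adp_annot_le a : is_adp a -> adp_annot_le (flat_adp a) a.
Proof.
move=> /flat_adp_lhs lhsE; split=> //; exists flat => //.
exact: flat_annot_le.
Qed.

Lemma adp_step_annot_le P a a' (K : choiceType) (q : K -> R)
    (lab : K -> term S X) (ks : seq K) ann s s' :
  adp_annot_le a a' -> annot_le s s' -> uniq ks ->
  adp_step P a ann s (seq_mset [seq (q k, lab k) | k <- ks]) ->
  exists (lab' : K -> term S X) (ann' : bool),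
    [/\ {in ks, forall k, annot_le (lab k) (lab' k)}, ann -> ann' &
        adp_step P a' ann' s' (seq_mset [seq (q k, lab' k) | k <- ks])].
Proof.
move=> [lhsE flagE [h h_le rhsE]] ss' uks.
move=> [sigma [p [ps annE [redexE nf] dE]]].
move: ps annE; rewrite !mem_pos_in => /andP[root_p ps].
rewrite ps andbT => annE.
have ps' : p \in positions s' by rewrite -(annot_le_positions ss').
have sub_le := annot_le_subterm p ss'.
pose ann' := root_in (@annotated S) (subterm s' p).
have ann_le : ann -> ann' by rewrite -annE; apply: annot_le_root.
move: dE; rewrite rhsE mset_map_comp => /eq_seq_msetP.
move=> /(perm_map_lift (0, s) uks)[g pg gE].
exists (fun k => contract ann' (flag a') s' p sigma (g k).2), ann'; split=> //.
  by move=> k /gE /= [_ ->]; rewrite flagE; apply: annot_le_contract.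
exists sigma, p; split.
- rewrite mem_pos_in ps' andbT.
  by apply: annot_le_root root_p => // d; rewrite /= orbT.
- by rewrite mem_pos_in ps' andbT.
- by rewrite -lhsE -(annot_le_eq_flat sub_le).
apply/eq_seq_msetP.
rewrite (_ : [seq (q k, _) | k <- ks] = [seq (x.1,
    contract ann' (flag a') s' p sigma x.2) | x <- map g ks]); last first.
  by rewrite -map_comp; apply/eq_in_map => k /gE /= [->].
exact: perm_map.
Qed.

End Steps.

(** * Sub-Markov chains *)

Section Squash.
Context {R : realFieldType}.
Implicit Types x y : R.

Definition squash x : R := x / (1 + x).

Definition squash_gap x y : R := (y - x) ^+ 2 / ((1 + x) ^+ 2 * (1 + y)).

Lemma squash_ge0 x : 0 <= x -> 0 <= squash x.
Proof. by move=> x0; rewrite divr_ge0 ?addr_ge0. Qed.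

Lemma squash_le1 x : 0 <= x -> squash x <= 1.
Proof. by move=> x0; rewrite ler_pdivrMr ?mul1r ?lerDr // ltr_wpDr. Qed.

Lemma squash_gap_ge0 x y : 0 <= y -> 0 <= squash_gap x y.
Proof.
by move=> y0; rewrite divr_ge0 ?sqr_ge0 // mulr_ge0 ?sqr_ge0 ?addr_ge0.
Qed.

Lemma squash_gap_ge x y : 0 <= y -> y + 1 <= x ->
  ((1 + x) ^+ 3)^-1 <= squash_gap x y.
Proof.
move=> y0 yx; have y1 : 0 < 1 + y by rewrite ltr_wpDr.
have x1 : 0 < 1 + x by lra.
rewrite ler_pdivlMr ?mulr_gt0 ?exprn_gt0 // ler_pdivrMl ?exprn_gt0 //.
rewrite [_ ^+ 3]exprSr -[leRHS]mulrA ler_pM2l ?exprn_gt0 //.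
have : 1 <= (y - x) ^+ 2 by nra.
by nra.
Qed.

(* The Taylor expansion of [squash] at x; the gap is the gain from concavity. *)
Lemma squash_expansion x y : 0 <= x -> 0 <= y ->
  squash y + squash_gap x y = (x / (1 + x)) ^+ 2 + ((1 + x) ^+ 2)^-1 * y.
Proof.
move=> x0 y0; rewrite /squash /squash_gap; field.
by rewrite !gt_eqF // ltr_wpDr.
Qed.

End Squash.

(* The missing mass [1 - \sum_w trans v w] is the probability of dying at v. *)
Record submarkov (R : realType) (T : eqType) := SubMarkov {
  succ : T -> seq T;
  trans : T -> T -> R;
  trans_ge0 : forall v w, w \in succ v -> 0 <= trans v w;
  trans_le1 : forall v, \sum_(w <- succ v) trans v w <= 1
}.

Section SubMarkovChains.
Context {R : realType} {T : eqType}.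
Implicit Types (M : submarkov R T) (f g V W : T -> R) (K : set T) (v w : T).

Definition avg M f v : R := \sum_(w <- succ M v) trans M v w * f w.

Definition survival M n : T -> R := iter n (avg M) (fun=> 1).

Definition escape M v : R := limn (survival M ^~ v).

Section StoppedChain.
Variables (K : set T) (M : submarkov R T).

Definition stopped_succ v : seq T := if v \in K then [::] else succ M v.

Fact stopped_trans_ge0 v w : w \in stopped_succ v -> 0 <= trans M v w.
Proof. by rewrite /stopped_succ; case: ifP => // _; apply: trans_ge0. Qed.

Fact stopped_trans_le1 v : \sum_(w <- stopped_succ v) trans M v w <= 1.
Proof.
by rewrite /stopped_succ; case: ifP => _; [rewrite big_nil|exact: trans_le1].
Qed.

Definition stopped_chain : submarkov R T :=
  SubMarkov stopped_trans_ge0 stopped_trans_le1.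

Lemma avg_stopped f v :
  avg stopped_chain f v = if v \in K then 0 else avg M f v.
Proof.
by rewrite /avg /= /stopped_succ; case: ifP => // _; rewrite big_nil.
Qed.

End StoppedChain.

Lemma ler_avg M f g v :
  {in succ M v, forall w, f w <= g w} -> avg M f v <= avg M g v.
Proof.
move=> fg; rewrite /avg big_seq [leRHS]big_seq; apply: ler_sum => w vw.
by rewrite ler_wpM2l ?trans_ge0 ?fg.
Qed.

Lemma avg_ge0 M f v : {in succ M v, forall w, 0 <= f w} -> 0 <= avg M f v.
Proof.
move=> f0; rewrite /avg big_seq; apply: sumr_ge0 => w vw.
by rewrite mulr_ge0 ?trans_ge0 ?f0.
Qed.

Lemma avg_ge_term M f v w : {in succ M v, forall u, 0 <= f u} ->
  w \in succ M v -> trans M v w * f w <= avg M f v.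
Proof.
move=> f0 vw; rewrite /avg (big_rem w) //= lerDl big_seq; apply: sumr_ge0 => u.
by move=> /mem_rem vu; rewrite mulr_ge0 ?trans_ge0 ?f0.
Qed.

Lemma avg_cst M (a : R) v : avg M (fun=> a) v = avg M (fun=> 1) v * a.
Proof. by rewrite /avg mulr_suml; under [RHS]eq_bigr do rewrite mulr1. Qed.

Lemma avg_cst_le M (a : R) v : 0 <= a -> avg M (fun=> a) v <= a.
Proof.
move=> a0; rewrite avg_cst ler_piMl // /avg.
by under eq_bigr do rewrite mulr1; exact: trans_le1.
Qed.

Lemma avgD M f g v : avg M (f \+ g) v = avg M f v + avg M g v.
Proof. by rewrite /avg -big_split; apply: eq_bigr => w _; rewrite mulrDr. Qed.

Lemma avgZ M (a : R) f v : avg M (a \*o f) v = a * avg M f v.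
Proof. by rewrite /avg mulr_sumr; apply: eq_bigr => w _; rewrite mulrCA. Qed.

Lemma avgB M f g v : avg M (f \- g) v = avg M f v - avg M g v.
Proof. by rewrite /avg -sumrB; apply: eq_bigr => w _; rewrite mulrBr. Qed.

Lemma survival_ge0 M n v : 0 <= survival M n v.
Proof. by elim: n v => [//|n IH] v; apply: avg_ge0 => w _. Qed.

Lemma survival_nonincreasing M v : nonincreasing_seq (survival M ^~ v).
Proof.
apply/nonincreasing_seqP => n; elim: n v => [|n IH] v; first exact: avg_cst_le.
by apply: ler_avg => w _; exact: IH.
Qed.

Lemma is_cvg_survival M v : cvgn (survival M ^~ v).
Proof.
apply: nonincreasing_is_cvgn; first exact: survival_nonincreasing.
by exists 0 => _ [n _ <-]; apply: survival_ge0.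
Qed.

Lemma escape_ge0 M v : 0 <= escape M v.
Proof.
apply: limr_ge; first exact: is_cvg_survival.
by apply: nearW => n; apply: survival_ge0.
Qed.

Lemma escape_le1 M v : escape M v <= 1.
Proof.
exact: (nonincreasing_cvgn_ge (@survival_nonincreasing M v)
  (@is_cvg_survival M v) 0%N).
Qed.

Lemma escape_harmonic M v : avg M (escape M) v = escape M v.
Proof.
rewrite [RHS]/escape; apply/esym/cvg_lim => //.
rewrite -(cvg_shiftS (survival M ^~ v)).
apply: cvg_big => [|w _]; first exact: add_continuous.
by apply: cvgMl_tmp; apply: is_cvg_survival.
Qed.

Lemma subharmonic_le_escape M f :
  (forall v, f v <= avg M f v) -> (forall v, f v <= 1) ->
  forall v, f v <= escape M v.
Proof.
move=> f_sub f_le1 v; apply: limr_ge; first exact: is_cvg_survival.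
apply: nearW => n; elim: n v => [|n IH] v; first exact: f_le1.
by apply: le_trans (f_sub v) (ler_avg _) => w _.
Qed.

Section Comparison.
Variables (M : submarkov R T) (K : set T) (f W : T -> R) (eta : R).
Hypothesis f_sub : forall v, f v <= avg M f v.
Hypothesis f_le1 : forall v, f v <= 1.
Hypothesis W_super : forall v, avg M W v <= W v.
Hypothesis W_ge0 : forall v, 0 <= W v.
Hypothesis stopped_escape0 : forall v, escape (stopped_chain K M) v = 0.

Lemma comparison_principle (a : R) : 0 <= a ->
  (forall v, K v -> 0 < f v -> f v <= a * W v) -> forall v, f v <= a * W v.
Proof.
move=> a0 faW v; rewrite -subr_le0 -(stopped_escape0 v).
apply: (@subharmonic_le_escape _ (f \- (a \*o W))) => {}v /=; last first.
  by rewrite (le_trans _ (f_le1 v)) // gerDl oppr_le0 mulr_ge0.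
rewrite avg_stopped; case: ifPn => [/set_mem Kv|_].
  have [/(faW v Kv)|fv] := ltP 0 (f v); rewrite subr_le0 //.
  by rewrite (le_trans fv) // mulr_ge0.
by rewrite avgB avgZ lerB // ler_wpM2l.
Qed.

Hypothesis eta_gt0 : 0 < eta.
Hypothesis W_le1 : forall v, W v <= 1.
Hypothesis W_drop : forall v, K v -> 0 < f v -> avg M W v + eta <= W v.

(* Where W drops, [f <= avg f <= a avg W <= a (W - eta) <= a / (1 + eta) W]. *)
Lemma comparison_contract (a : R) : 0 <= a ->
  (forall v, f v <= a * W v) -> forall v, f v <= a / (1 + eta) * W v.
Proof.
have eta1 : 0 < 1 + eta by rewrite addr_gt0.
move=> a0 faW; apply: comparison_principle => [|v Kv fv].
  by rewrite divr_ge0 // ltW.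
have f_avgW : f v <= a * avg M W v.
  by rewrite (le_trans (f_sub v)) // -avgZ ler_avg.
rewrite (le_trans f_avgW) // -mulrA ler_wpM2l // mulrC ler_pdivlMr //.
rewrite mulrDr mulr1 (le_trans _ (W_drop Kv fv)) // lerD2l ger_pMl //.
exact: le_trans (W_super v) (W_le1 v).
Qed.

Lemma subharmonic_le0 v : f v <= 0.
Proof.
have inv_eta_ge0 : 0 <= eta^-1 by rewrite invr_ge0 ltW.
have ratio_ge0 : 0 <= (1 + eta)^-1 by rewrite invr_ge0 addr_ge0 // ltW.
pose a := geometric eta^-1 (1 + eta)^-1.
have f_le n : f v <= a n * W v.
  elim: n v => [|n IH].
    apply: comparison_principle => [|v Kv fv]; rewrite /a /= expr0 mulr1 //.
    rewrite (le_trans (f_le1 v)) // ler_pdivlMl // mulr1.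
    by rewrite (le_trans _ (W_drop Kv fv)) // lerDr avg_ge0.
  rewrite /a /= exprSr mulrA; apply: comparison_contract IH.
  by rewrite /a /= mulr_ge0 ?exprn_ge0.
have a_to0 : a n @[n --> \oo] --> (0 : R).
  by apply: cvg_geometric; rewrite ger0_norm // invf_lt1 ?ltrDl ?addr_gt0.
rewrite -[leRHS](mul0r (W v)).
apply: ler_cvg_to (cvg_cst (f v)) (cvgMr_tmp (b := W v) a_to0) _.
exact: nearW.
Qed.

End Comparison.

Lemma avg_squash M V v : (forall w, 0 <= V w) -> avg M V v <= V v ->
  avg M (squash \o V) v + avg M (squash_gap (V v) \o V) v <= squash (V v).
Proof.
move=> V0 V_super; have x0 := V0 v; set x := V v in x0 *; rewrite -avgD.
have -> : avg M ((squash \o V) \+ (squash_gap x \o V)) v =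
    avg M (fun=> (x / (1 + x)) ^+ 2) v + ((1 + x) ^+ 2)^-1 * avg M V v.
  rewrite -avgZ -avgD; congr avg; apply/funext => w /=.
  exact: squash_expansion.
have -> : squash x = (x / (1 + x)) ^+ 2 + ((1 + x) ^+ 2)^-1 * x.
  by rewrite /squash; field; rewrite gt_eqF // ltr_wpDr.
apply: lerD; first by rewrite avg_cst_le // sqr_ge0.
by rewrite ler_wpM2l // invr_ge0 sqr_ge0.
Qed.

Lemma avg_squash_drop M V v w (delta N : R) : (forall w, 0 <= V w) ->
  avg M V v <= V v -> w \in succ M v -> 0 <= delta <= trans M v w ->
  V w + 1 <= V v -> V v <= N ->
  avg M (squash \o V) v + delta / (1 + N) ^+ 3 <= squash (V v).
Proof.
move=> V0 V_super vw /andP[delta0 delta_le] VwVv VN.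
apply: le_trans (avg_squash V0 V_super); rewrite lerD2l.
apply: le_trans (avg_ge_term _ vw); last by move=> u _; apply: squash_gap_ge0.
have N0 : 0 <= N := le_trans (V0 v) VN.
apply: ler_pM => //=; first by rewrite invr_ge0 exprn_ge0 ?addr_ge0.
apply: le_trans (squash_gap_ge (V0 w) VwVv).
rewrite lef_pV2 ?posrE ?exprn_gt0 ?ltr_wpDr //.
by rewrite lerXn2r ?nnegrE ?addr_ge0 // lerD2l.
Qed.

Lemma drift_escape0 M K V (delta : R) : 0 < delta ->
  (forall v, 0 <= V v) -> (forall v, avg M V v <= V v) ->
  (forall v, K v -> exists2 w, w \in succ M v &
     delta <= trans M v w /\ V w + 1 <= V v) ->
  (forall v, escape (stopped_chain K M) v = 0) ->
  forall v, escape M v = 0.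
Proof.
move=> delta0 V0 V_super V_drop escK v.
have escape_le (e : R) : 0 < e -> escape M v <= e * V v.
  move=> e0; rewrite -subr_le0.
  have eta0 : 0 < delta / (1 + e^-1) ^+ 3.
    by rewrite divr_gt0 // exprn_gt0 // addr_gt0 // invr_gt0.
  apply: (subharmonic_le0 (M := M) (K := K) (f := escape M \- (e \*o V))
    (W := squash \o V) _ _ _ _ escK eta0) => {}v /=.
  - by rewrite avgB avgZ escape_harmonic lerB // ler_wpM2l // ltW.
  - rewrite (le_trans _ (escape_le1 M v)) // gerDl oppr_le0 mulr_ge0 //.
    exact: ltW.
  - apply: le_trans (avg_squash V0 (V_super v)).
    by rewrite lerDl avg_ge0 // => w _; apply: squash_gap_ge0.
  - exact: squash_ge0.
  - exact: squash_le1.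
  move=> Kv; rewrite subr_gt0 => eV_lt.
  have [w vw [delta_le VwVv]] := V_drop v Kv.
  apply: (avg_squash_drop V0 (V_super v) vw _ VwVv); first by rewrite ltW.
  by rewrite -[leRHS]mulr1 ler_pdivlMl // (le_trans (ltW eV_lt)) ?escape_le1.
apply/le_anti; rewrite escape_ge0 andbT; apply/ler_addgt0Pr => e e0.
have V1 : 0 < V v + 1 by rewrite ltr_wpDl.
rewrite add0r; apply: le_trans (escape_le (e / (V v + 1)) _) _.
  by rewrite divr_gt0.
by rewrite mulrAC ler_pdivrMr // ler_wpM2l ?(ltW e0) // lerDl.
Qed.

End SubMarkovChains.

(** * Trees *)

Lemma esum_bigcup_disjoint (R : realType) (I T : choiceType) (K : set I)
    (J : I -> set T) (a : T -> \bar R) :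
  (forall i j x, J i x -> J j x -> i = j) ->
  (forall i x, J i x -> (0 <= a x)%E) ->
  \esum_(x in \bigcup_(i in K) J i) a x =
  \esum_(i in K) \esum_(x in J i) a x.
Proof.
move=> J_inj a0; rewrite esum_esum => [|i x _ /a0 //].
apply: (reindex_esum _ _ snd); split.
- by move=> [i x] [/= Ki Jx]; exists i.
- move=> [i x] [j y] /set_mem[/= _ Jx] /set_mem[/= _ Jy] xy.
  by rewrite -xy in Jy *; rewrite (J_inj i j x).
- by move=> x [i Ki Jx]; exists (i, x).
Qed.

Section Trees.
Context {S : signature} {X : Type} {R : realType}.
Variable T : @ltree S X R.
Implicit Types (u v w x : carrier T).

Fixpoint descendant n v x : Prop :=
  if n is m.+1 then exists2 w, edge v w & descendant m w x else v = x.

Lemma descendant_rcons n v u x :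
  descendant n v u -> edge u x -> descendant n.+1 v x.
Proof.
elim: n v => [v /= -> ux|n IH v [w vw wu] ux]; first by exists x.
by exists w => //; apply: IH.
Qed.

Lemma descendant_parent n v x :
  descendant n.+1 v x -> exists2 u, descendant n v u & edge u x.
Proof.
elim: n v => [v [w vw /= <-]|n IH v [w vw /IH[u wu ux]]]; first by exists v.
by exists u => //; exists w.
Qed.

Lemma descendant_trans m n u v w :
  descendant m u v -> descendant n v w -> descendant (m + n) u w.
Proof.
by elim: m u => [u -> //|m IH u [x ux xv] vw]; exists x => //; apply: IH.
Qed.

Hypothesis treeT : is_tree T.

Lemma edge_nodes v w : edge v w -> nodes v /\ nodes w.
Proof. by have [+ _ _] := treeT; apply. Qed.

Lemma edge_parent_inj u v x : edge u x -> edge v x -> u = v.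
Proof. by have [_ + _] := treeT; apply. Qed.

Lemma descendant_ancestor_inj n v w x :
  descendant n v x -> descendant n w x -> v = w.
Proof.
elim: n v w => [v w /= -> ->//|n IH v w [v' vv' v'x] [w' ww' w'x]].
by apply: edge_parent_inj vv' _; rewrite (IH v' w').
Qed.

Variable r : carrier T.
Hypothesis rootT : is_root r.

Lemma root_descendant v : nodes v -> exists n, descendant n r v.
Proof.
case: rootT => _ _ /[apply]; elim=> {v} [u v uv|u|u v w _ [m uv] _ [n vw]].
- by exists 1%N; exists v.
- by exists 0%N.
- by exists (m + n)%N; apply: descendant_trans uv vw.
Qed.

Lemma root_depth_inj m n v : descendant m r v -> descendant n r v -> m = n.
Proof.
have no_cycle k : ~ descendant k.+1 r r.
  by move=> /descendant_parent[u _]; case: rootT => _ /(_ u).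
elim: m n v => [|m IH] [|n] v //.
- by move=> /= <- /no_cycle.
- by move=> + /= rv; rewrite -rv => /no_cycle.
move=> /descendant_parent[u ru uv] /descendant_parent[u' ru' u'v].
by congr _.+1; apply: IH ru _; rewrite (edge_parent_inj uv u'v).
Qed.

Lemma tree_recursion (A : Type) (a0 : A)
    (f : carrier T -> A -> carrier T -> A) :
  exists g : carrier T -> A,
    g r = a0 /\ forall v w, edge v w -> g w = f v (g v) w.
Proof.
pose parent w := xget w [set v | edge v w].
pose depth w := xget 0%N [set n | descendant n r w].
have depthE n w : descendant n r w -> depth w = n.
  move=> rw; apply: (root_depth_inj _ rw).
  exact: (@xgetI _ 0%N [set n | descendant n r w] n rw).
have parentE v w : edge v w -> parent w = v.
  move=> vw; apply: (edge_parent_inj _ vw).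
  exact: (@xgetI _ w [set v | edge v w] v vw).
pose L := fix L n w :=
  if n is m.+1 then f (parent w) (L m (parent w)) w else a0.
exists (fun w => L (depth w) w); split; first by rewrite (depthE 0%N).
move=> v w vw; have [n rv] := root_descendant (edge_nodes vw).1.
rewrite (depthE _ _ rv) (depthE _ _ (descendant_rcons rv vw)) /=.
by rewrite (parentE _ _ vw).
Qed.

Lemma tree_labelling (A : Type) (a0 : A) (good : carrier T -> A -> Prop)
    (compatible : carrier T -> A -> (carrier T -> A) -> Prop) :
  good r a0 ->
  (forall v a, nodes v -> good v a -> exists2 g,
     compatible v a g & forall w, edge v w -> good w (g w)) ->
  exists lab : carrier T -> A, forall v, nodes v ->
    good v (lab v) /\
    exists2 g, compatible v (lab v) g & forall w, edge v w -> lab w = g w.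
Proof.
move=> good0 extend.
have /choice[F FP] (va : carrier T * A) : exists g,
    nodes va.1 -> good va.1 va.2 ->
    compatible va.1 va.2 g /\ forall w, edge va.1 w -> good w (g w).
  case: va => v a /=.
  have [[nv va]|bad] := pselect (nodes v /\ good v a).
    by have [g] := extend v a nv va; exists g.
  by exists (fun=> a0) => nv va; case: bad.
have [lab [lab_r labE]] := tree_recursion a0 (fun v a w => F (v, a) w).
have good_lab v : nodes v -> good v (lab v).
  move=> /root_descendant[n]; elim: n v => [v <-|n IH v].
    by rewrite lab_r.
  move=> /descendant_parent[u /IH good_u uv]; rewrite (labE u) //.
  by have [_] := FP (u, lab u) (edge_nodes uv).1 good_u; apply.
exists lab => v nv; split; first exact: good_lab.
have [compat _] := FP (v, lab v) nv (good_lab v nv).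
by exists (F (v, lab v)) => // w; apply: labE.
Qed.

End Trees.

Section ProbTrees.
Context {S : signature} {X : Type} {R : realType}.

Definition children (T : @ltree S X R) (v : carrier T) : seq (carrier T) :=
  fset_set (edge v).

Record prob_tree (T : @ltree S X R) : Prop := ProbTree {
  pt_tree :> is_tree T;
  pt_finite : forall v : carrier T, finite_set (edge v);
  pt_gt0 : forall v : carrier T, nodes v -> 0 < prob v;
  pt_sum : forall v : carrier T, inner v ->
    \sum_(w <- children v) prob w = prob v
}.

Variable T : @ltree S X R.
Hypothesis ptT : prob_tree T.
Implicit Types (u v w x : carrier T) (f : carrier T -> R).

Lemma childrenP v w : reflect (edge v w) (w \in children v).
Proof.
rewrite in_fset_set; last exact: (pt_finite ptT).
by apply: (iffP idP) => [/set_mem|/mem_set].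
Qed.

Lemma children_leaf v : ~ inner v -> children v = [::].
Proof.
move=> leaf_v; rewrite /children (_ : edge v = set0) ?fset_set0 //.
apply/seteqP; split=> // w vw; apply: leaf_v; split; last by exists w.
by have [] := edge_nodes ptT vw.
Qed.

Fact child_prob_ge0 v w : w \in children v -> 0 <= prob w / prob v.
Proof.
move=> /childrenP /(edge_nodes ptT)[nv nw].
by rewrite divr_ge0 // ltW // (pt_gt0 ptT).
Qed.

Lemma sum_child_prob v : inner v ->
  \sum_(w <- children v) prob w / prob v = 1.
Proof.
move=> iv; rewrite -mulr_suml (pt_sum ptT iv) divff //.
by rewrite gt_eqF // (pt_gt0 ptT iv.1).
Qed.

Fact sum_child_prob_le1 v : \sum_(w <- children v) prob w / prob v <= 1.
Proof.
have [/sum_child_prob ->//|/children_leaf ->] := pselect (inner v).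
by rewrite big_nil.
Qed.

Definition tree_chain : submarkov R (carrier T) :=
  SubMarkov child_prob_ge0 sum_child_prob_le1.

Lemma avg_leaf f v : ~ inner v -> avg tree_chain f v = 0.
Proof. by move=> /children_leaf lv; rewrite /avg /= lv big_nil. Qed.

Lemma prob_avg f v : nodes v ->
  prob v * avg tree_chain f v = \sum_(w <- children v) prob w * f w.
Proof.
move=> nv; rewrite /avg mulr_sumr; apply: eq_bigr => w _.
by rewrite mulrA mulrCA divff ?mulr1 // gt_eqF // (pt_gt0 ptT).
Qed.

Definition level_leaves n v : set (carrier T) :=
  [set x | leaves x /\ descendant n v x].

Lemma level_leaves0 v : nodes v ->
  \esum_(x in level_leaves 0 v) (prob x)%:E =
  (prob v * (1 - avg tree_chain (fun=> 1) v))%:E.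
Proof.
move=> nv; have [iv|leaf_v] := pselect (inner v).
  rewrite (_ : level_leaves 0 v = set0); last first.
    apply/seteqP; split=> x //= [[_ +] vx]; rewrite -vx.
    by have [_ /set0P/eqP] := iv.
  rewrite esum_set0 /avg; under eq_bigr do rewrite mulr1.
  by rewrite sum_child_prob // subrr mulr0.
rewrite avg_leaf // subr0 mulr1 (_ : level_leaves 0 v = [set v]).
  by rewrite esum_set1 // lee_fin ltW // (pt_gt0 ptT).
apply/seteqP; split=> [x [_ <-]//|x ->]; split=> //; split=> //.
by apply/eqP/negP => /negP/set0P ev; apply: leaf_v.
Qed.

Lemma level_leaves_mass n v : nodes v ->
  \esum_(x in level_leaves n v) (prob x)%:E =
  (prob v * (survival tree_chain n v - survival tree_chain n.+1 v))%:E.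
Proof.
elim: n v => [|n IH] v nv; first exact: level_leaves0.
have -> : level_leaves n.+1 v = \bigcup_(w in edge v) level_leaves n w.
  apply/seteqP; split=> x /= [].
    by move=> lx [w vw wx]; exists w.
  by move=> w vw [lx wx]; split=> //; exists w.
rewrite esum_bigcup_disjoint; last 2 first.
- by move=> i j x [_ ix] [_ jx]; exact: (descendant_ancestor_inj ptT ix jx).
- by move=> w x [[nx _] _]; rewrite lee_fin ltW // (pt_gt0 ptT).
under eq_esum => w /(edge_nodes ptT)[_ nw] do rewrite IH //.
rewrite esum_fset; [|exact: (pt_finite ptT)|]; last first.
  move=> w /set_mem /(edge_nodes ptT)[_ nw]; rewrite lee_fin mulr_ge0 //.
    by rewrite ltW // (pt_gt0 ptT).
  by rewrite subr_ge0 survival_nonincreasing.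
rewrite fsbig_finite ?sumEFin; last exact: (pt_finite ptT).
rewrite -prob_avg // -/(survival tree_chain n \- survival tree_chain n.+1).
by rewrite avgB.
Qed.

Variable r : carrier T.
Hypothesis rootT : is_root r.

Lemma leaf_mass_levels : leaf_mass T = \esum_(n in setT)
  (prob r * (survival tree_chain n r - survival tree_chain n.+1 r))%:E.
Proof.
have nr : nodes r by case: rootT.
rewrite /leaf_mass
  (_ : @leaves _ _ _ T = \bigcup_(n in setT) level_leaves n r); last first.
  apply/seteqP; split=> x; last by move=> [n _ []].
  by move=> lx; have [n rx] := root_descendant rootT lx.1; exists n.
rewrite esum_bigcup_disjoint; last 2 first.
- by move=> i j x [_ ix] [_ jx]; exact: (root_depth_inj ptT rootT ix jx).
- by move=> n x [[nx _] _]; rewrite lee_fin ltW // (pt_gt0 ptT).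
by apply: eq_esum => n _; rewrite level_leaves_mass.
Qed.

Lemma leaf_massE : leaf_mass T = (prob r * (1 - escape tree_chain r))%:E.
Proof.
pose surv n := survival tree_chain n r.
have p0 : 0 < prob r by apply: (pt_gt0 ptT); case: rootT.
rewrite leaf_mass_levels -nneseries_esumT => [|n]; last first.
  by rewrite lee_fin mulr_ge0 ?(ltW p0) // subr_ge0 survival_nonincreasing.
apply/cvg_lim => //.
have partial_sum n : (\sum_(0 <= i < n) (prob r * (surv i - surv i.+1))%:E)%E =
    (prob r * (1 - surv n))%:E.
  rewrite sumEFin -mulr_sumr (telescope_sumr_eq (fun i => - surv i)) //.
    by rewrite opprK addrC.
  by move=> i _; rewrite opprK addrC.
under eq_fun do rewrite partial_sum.
apply: cvg_EFin; first exact: nearW.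
apply: cvgMl_tmp; apply: cvgB; first exact: cvg_cst.
exact: is_cvg_survival.
Qed.

End ProbTrees.

(** * Chain trees *)

Section ChainTrees.
Context {S : signature} {X : Type} {R : realType}.
Implicit Types (P Q : set (adp S X R)) (T : @ltree S X R).

Definition node_step P T (v : carrier T) : Prop :=
  step P `[< nodesP v >] (label v) (children_dist v).

Lemma chain_tree_step P T (v : carrier T) :
  chain_tree P T -> inner v -> node_step P v.
Proof.
move=> ctT iv; rewrite /node_step; case: asboolP => Pv.
  exact: ct_stepP ctT _ Pv.
exact: ct_stepR ctT _ iv Pv.
Qed.

Lemma big_children_dist T (v : carrier T) (F : R * term S X -> R) :
  \sum_(y <- children_dist v) F y =
  \sum_(w <- children v) F (prob w / prob v, label w).
Proof. by rewrite (perm_big _ (perm_eq_seq_mset _)) big_map. Qed.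

Lemma step_sum1 P ann (t : term S X) (d : {mset R * term S X}) :
  (forall a, P a -> is_adp a) -> step P ann t d -> \sum_(y <- d) y.1 = 1.
Proof.
move=> P_adp /stepP[a /P_adp[_ _ [_ sum1] _] [sigma [p [_ _ _ ->]]]].
by rewrite big_mset_map.
Qed.

Lemma chain_tree_prob_tree P T :
  (forall a, P a -> is_adp a) -> chain_tree P T -> prob_tree T.
Proof.
move=> P_adp ctT; have treeT := ct_tree ctT; split=> // [v|v|v iv].
- have [nv|nv] := pselect (nodes v); first exact: ct_finite ctT v nv.
  rewrite (_ : edge v = set0) //; apply/seteqP; split=> w // vw.
  by apply: nv; have [] := edge_nodes treeT vw.
- by move=> /(ct_prob ctT)/andP[].
have p0 : 0 < prob v by have /andP[] := ct_prob ctT iv.1.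
have := step_sum1 P_adp (chain_tree_step ctT iv).
rewrite big_children_dist /= -mulr_suml => sum1.
by rewrite -[LHS](divfK (lt0r_neq0 p0)) sum1 mul1r.
Qed.

Definition relabel T (lab : carrier T -> term S X) (nP : set (carrier T)) :
    @ltree S X R :=
  @LTree S X R (carrier T) (@nodes _ _ _ T) (@edge _ _ _ T) (@prob _ _ _ T)
    lab nP.

Definition relabelled_dist T (lab : carrier T -> term S X) (v : carrier T) :
    {mset R * term S X} :=
  seq_mset [seq (prob w / prob v, lab w) | w <- children v].

(* Relabelling can turn an unannotated step into an annotated one, so V_P has to
   be recomputed; it only grows, so infinite paths still visit it forever. *)
Lemma chain_tree_relabel P Q T (lab : carrier T -> term S X) :
  chain_tree Q T ->
  (forall v : carrier T, inner v -> exists2 ann : bool, nodesP v -> ann &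
     step P ann (lab v) (relabelled_dist lab v)) ->
  exists nP : set (carrier T), chain_tree P (relabel lab nP).
Proof.
move=> ctT lab_step.
exists [set v : carrier T | inner v /\
  step P true (lab v) (relabelled_dist lab v)]; split.
- exact: ct_tree ctT.
- exact: ct_finite ctT.
- exact: ct_prob ctT.
- exact: ct_root ctT.
- by move=> v [].
- by move=> v [].
- move=> v iv nPv; have [[] _ st] := lab_step v iv; last exact: st.
  by case: nPv.
- move=> u ue n; have [m nm Pm] := ct_infinite ctT ue n; exists m => //.
  have im := ct_nodesP ctT Pm; split=> //.
  by have [ann /(_ Pm) ->] := lab_step _ im.
Qed.

Section MoreAnnotations.
Variables P Q : set (adp S X R).
Hypothesis lhs_sub : left_sides P `<=` left_sides Q.
Hypothesis annot_le_PQ : forall a, Q a -> exists2 a', P a' & adp_annot_le a a'.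

Lemma step_annot_le (K : choiceType) (q : K -> R) (lab : K -> term S X)
    (ks : seq K) (ann : bool) (s s' : term S X) :
  uniq ks -> annot_le s s' ->
  step Q ann s (seq_mset [seq (q k, lab k) | k <- ks]) ->
  exists (lab' : K -> term S X) (ann' : bool),
    [/\ {in ks, forall k, annot_le (lab k) (lab' k)}, ann -> ann' &
        step P ann' s' (seq_mset [seq (q k, lab' k) | k <- ks])].
Proof.
move=> uks ss' /stepP[a Qa st]; have [a' Pa' aa'] := annot_le_PQ Qa.
have [lab' [ann' [lab_le ann_le st']]] :=
  adp_step_annot_le aa' ss' uks (adp_step_sub lhs_sub st).
by exists lab', ann'; split=> //; apply/stepP; exists a'.
Qed.

Lemma chain_tree_annot_le T : chain_tree Q T ->
  exists (lab : carrier T -> term S X) (nP : set (carrier T)),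
    chain_tree P (relabel lab nP).
Proof.
move=> ctT; have [_ _ [r rootT]] := ct_tree ctT.
have mem_children (v w : carrier T) :
    nodes v -> w \in children v = (w \in edge v).
  by move=> nv; rewrite in_fset_set //; apply: (ct_finite ctT).
have [|v t nv v_le|lab labP] := @tree_labelling _ _ _ T (ct_tree ctT) r rootT _
    (label r) (fun v t => annot_le (label v) t)
    (fun v t g => inner v -> exists2 ann : bool, nodesP v -> ann &
       step P ann t (relabelled_dist g v)).
- exact: annot_le_refl.
- have [iv|leaf_v] := pselect (inner v); last first.
    by exists (@label _ _ _ T) => // w _; apply: annot_le_refl.
  have [g [ann [g_le ann_le st]]] :=
    step_annot_le (fset_uniq _) v_le (chain_tree_step ctT iv).
  exists g => [_|w vw]; last by apply: g_le; rewrite mem_children // inE.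
  by exists ann => // Pv; apply: ann_le; apply/asboolP.
exists lab; apply: (chain_tree_relabel ctT) => v iv.
have [_ [g /(_ iv)[ann annP st] labE]] := labP v iv.1.
exists ann => //; rewrite (_ : relabelled_dist lab v = relabelled_dist g v) //.
congr seq_mset; apply/eq_in_map => w.
by rewrite mem_children ?inE => [/labE ->|]; last exact: iv.1.
Qed.

Lemma iAST_annot_le : iAST P -> iAST Q.
Proof.
by move=> astP T /chain_tree_annot_le[lab [nP /astP <-]].
Qed.

End MoreAnnotations.

End ChainTrees.

Section StoppedSubtree.
Context {S : signature} {X : Type} {R : realType}.
Variables (T : @ltree S X R) (K : set (carrier T)) (v0 : carrier T).

Let live_edge (u w : carrier T) : Prop := edge u w /\ ~ K u.
Let live : set (carrier T) := [set u | clos_refl_trans_n1 _ live_edge v0 u].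

Definition stopped_subtree : @ltree S X R := @LTree S X R
  (carrier T) live (fun u => [set w | live_edge u w /\ live u])
  (fun u => prob u / prob v0) (@label S X R T)
  [set u | [/\ nodesP u, ~ K u & live u]].

Local Notation T0 := stopped_subtree.

Hypotheses (ptT : prob_tree T) (nodes_v0 : nodes v0).

Lemma live_child u w : live u -> ~ K u -> edge u w -> live w.
Proof. by move=> lu Ku uw; apply: (@rtn1_trans _ live_edge v0 u w). Qed.

Lemma live_descendant u : live u -> exists n, descendant n v0 u.
Proof.
elim=> [|u' w [u'w _] _ [n v0u]]; first by exists 0%N.
by exists n.+1; apply: descendant_rcons u'w.
Qed.

Lemma live_node u : live u -> nodes u.
Proof. by case=> // w u' [/(edge_nodes ptT)[]]. Qed.

Lemma edge_stopped (u : carrier T) :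
  live u -> ~ K u -> @edge _ _ _ T0 u = edge u.
Proof. by move=> lu Ku; apply/seteqP; split=> w /=; [case=> -[]|]. Qed.

Lemma children_stopped (u : carrier T) : live u ->
  @children _ _ _ T0 u = if u \in K then [::] else children u.
Proof.
move=> lu; rewrite /children; case: ifPn => [/set_mem Ku|].
  rewrite (_ : edge _ = set0) ?fset_set0 //.
  by apply/seteqP; split=> w // -[[]].
by rewrite notin_setE => Ku; rewrite edge_stopped.
Qed.

Lemma prob_stopped_ratio (u w : carrier T) :
  @prob _ _ _ T0 w / @prob _ _ _ T0 u = prob w / prob u.
Proof.
by rewrite /= invf_div mulrA divfK // gt_eqF // (pt_gt0 ptT).
Qed.

Lemma inner_stopped (u : carrier T) : @inner _ _ _ T0 u ->
  [/\ live u, ~ K u & inner u].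
Proof.
move=> [lu [w [[uw Ku] _]]]; split=> //; split; first exact: live_node.
by exists w.
Qed.

Lemma live_prob_le u : live u -> prob u <= prob v0.
Proof.
elim=> // x w [xw _] lx; apply: le_trans.
have [nx nw] := edge_nodes ptT xw.
have xw' : w \in succ (tree_chain ptT) x by apply/(childrenP ptT).
rewrite -[leRHS]mul1r -ler_pdivrMr ?(pt_gt0 ptT) // -[leLHS]mulr1.
apply: le_trans (avg_ge_term (f := fun=> 1) _ xw') _ => //.
exact: avg_cst_le.
Qed.

Lemma children_dist_stopped (u : carrier T) : live u -> ~ K u ->
  @children_dist _ _ _ T0 u = children_dist u.
Proof.
move=> lu Ku; rewrite /children_dist edge_stopped //; congr seq_mset.
by apply: eq_map => w; rewrite prob_stopped_ratio.
Qed.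

Variable r : carrier T.
Hypothesis rootT : is_root r.

Lemma root_stopped : @is_root _ _ _ T0 v0.
Proof.
split; first exact: rtn1_refl.
  move=> u [[uv _] lu]; have [k v0u] := live_descendant lu.
  have [n rv0] := root_descendant rootT nodes_v0.
  have := root_depth_inj ptT rootT rv0
    (descendant_trans rv0 (descendant_rcons v0u uv)).
  by rewrite -[LHS]addn0 => /addnI.
move=> u lu; have : live u := lu; elim=> [|x w xw lx IH].
  exact: rt_refl.
by apply: rt_trans IH _; apply: rt_step; split.
Qed.

Lemma tree_stopped : is_tree T0.
Proof.
split; last by exists v0; apply: root_stopped.
  by move=> u w [[uw Ku] lu]; split; [exact: lu|exact: live_child uw].
by move=> u v w [[uw _] _] [[vw _] _]; exact: (edge_parent_inj ptT uw vw).
Qed.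

Lemma prob_tree_stopped : prob_tree T0.
Proof.
split; first exact: tree_stopped.
- by move=> u; apply: sub_finite_set (pt_finite ptT u) => w [[]].
- by move=> u /live_node nu; rewrite divr_gt0 ?pt_gt0.
- move=> u /inner_stopped[lu Ku iu]; rewrite /children edge_stopped //.
  by rewrite -mulr_suml (pt_sum ptT).
Qed.

Lemma survival_stopped n (u : carrier T) : live u ->
  survival (tree_chain prob_tree_stopped) n u =
  survival (stopped_chain K (tree_chain ptT)) n u.
Proof.
elim: n u => [//|n IH u lu] /=.
rewrite /avg /= children_stopped // /stopped_succ.
case: ifPn => [_|]; first by rewrite !big_nil.
rewrite notin_setE => Ku; apply: eq_big_seq => w /(childrenP ptT) uw.
by rewrite -(prob_stopped_ratio u w) IH //; apply: live_child uw.
Qed.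

Lemma escape_stopped : escape (tree_chain prob_tree_stopped) v0 =
  escape (stopped_chain K (tree_chain ptT)) v0.
Proof.
congr (limn _); apply/funext => n; apply: survival_stopped.
exact: rtn1_refl.
Qed.

Lemma chain_tree_stopped (P Q : set (adp S X R)) : chain_tree P T ->
  (forall v : carrier T, inner v -> ~ K v -> node_step Q v) ->
  chain_tree Q T0.
Proof.
move=> ctT Q_step; split; first exact: tree_stopped.
- by move=> u _; apply: (pt_finite prob_tree_stopped).
- move=> u lu; rewrite (pt_gt0 prob_tree_stopped) //=.
  by rewrite ler_pdivrMr ?mul1r ?live_prob_le // (pt_gt0 ptT).
- move=> v [lv nov _] /=; rewrite (_ : v = v0) ?divff ?gt_eqF ?(pt_gt0 ptT) //.
  by case: (lv : live v) nov => // x w xw lx /(_ x)[].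
- move=> u [/(ct_nodesP ctT)[nu [w uw]] Ku lu].
  by split=> //; exists w; split.
- move=> u [Pu Ku lu]; rewrite children_dist_stopped //.
  by have := Q_step u (ct_nodesP ctT Pu) Ku; rewrite /node_step asboolT.
- move=> u /inner_stopped[lu Ku iu] nPu; rewrite children_dist_stopped //.
  have := Q_step u iu Ku; rewrite /node_step asboolF // => Pu.
  by apply: nPu.
- move=> u ue n; have [|m nm Pm] := ct_infinite ctT (u := u) _ n.
    by move=> k; have [[]] := ue k.
  by exists m => //; have [[_ Ku] lu] := ue m.
Qed.

End StoppedSubtree.

(** * The reduction pair processor *)

Lemma finite_set_pos_lower_bound (R : realDomainType) (A : set R) :
  finite_set A -> (forall x, A x -> 0 < x) ->
  exists2 d : R, 0 < d & forall x, A x -> d <= x.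
Proof.
move=> /finite_seqP[s ->] s0; exists (\big[Num.min/1]_(x <- s) x).
  by rewrite big_seq; apply: lt_bigmin => // x; apply: s0.
by move=> x xs; apply: (ge_bigmin_seq 1 x xpredT id).
Qed.

Lemma adp_problem_min_prob (S : signature) (X : Type) (R : realType)
    (P : set (adp S X R)) : adp_problem P ->
  exists2 delta : R, 0 < delta &
    forall a x, P a -> x \in rhs a -> delta <= x.1.
Proof.
move=> [finP P_adp].
have [||d d0 dP] := @finite_set_pos_lower_bound R
    (\bigcup_(a in P) [set x.1 | x in [set` rhs a]]).
- apply: bigcup_finite => // a _; apply: finite_image.
  exact: (finite_seq (enum_mset (rhs a))).
- by move=> _ [a /P_adp[_ _ [pos _] _] [x xa <-]]; have /andP[] := pos x xa.
by exists d => // a x Pa xa; apply: dP; exists a => //; exists x.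
Qed.

Section Decrease.
Context {S : signature} {X : Type} {R : realType}.
Implicit Types (P : set (adp S X R)) (a : adp S X R) (s : term S X).
Variable Pol : polint S.

Definition flat_weakly_decreasing a : Prop :=
  flag a = true -> forall alpha : X -> nat,
    \sum_(x <- rhs a) x.1 * (pol Pol alpha (flat x.2))%:~R
      <= (pol Pol alpha (lhs a))%:~R :> R.

Definition annot_weakly_decreasing a : Prop :=
  forall alpha : X -> nat,
    \sum_(x <- rhs a) x.1 * (pol_annot Pol alpha x.2)%:~R
      <= (pol Pol alpha (sharp (lhs a)))%:~R :> R.

Definition annot_strictly_decreasing a : Prop :=
  exists x : R * term S X,
    [/\ x \in rhs a,
        forall alpha : X -> nat,
          pol_annot Pol alpha x.2 < pol Pol alpha (sharp (lhs a)) &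
        flag a = true -> forall alpha : X -> nat,
          pol Pol alpha (flat x.2) <= pol Pol alpha (lhs a)].

Hypothesis Pol_multilinear : multilinear Pol.

Lemma adp_step_pol_annot P a ann s d alpha : is_adp a ->
  adp_step P a ann s d ->
  exists beta (A B : int) (t : R * term S X -> term S X), [/\ 0 <= A,
    d = mset_map (fun x => (x.1, t x)) (rhs a),
    pol Pol beta (sharp (lhs a)) *+ ann + (A * pol Pol beta (lhs a)) *+ flag a
      + B <= pol_annot Pol alpha s &
    {in rhs a, forall x, pol_annot Pol alpha (t x) =
      pol_annot Pol beta x.2 *+ ann + (A * pol Pol beta (flat x.2)) *+ flag a
      + B}].
Proof.
move=> [plain_a root_a _ vars_a] [sigma [p [ps annE [redexE _] dE]]].
move: ps annE; rewrite !mem_pos_in => /andP[_ ps]; rewrite ps andbT => annE.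
have [beta [A [B [A0 s_ge valueE]]]] :=
  pol_annot_contract Pol_multilinear alpha (flag a) plain_a root_a ps annE
    redexE.
exists beta, A, B, (fun x => contract ann (flag a) s p sigma x.2); split=> //.
by move=> x /vars_a /valueE.
Qed.

Lemma step_pol_annot_average P a ann s d alpha : is_adp a ->
  flat_weakly_decreasing a -> annot_weakly_decreasing a ->
  adp_step P a ann s d ->
  \sum_(y <- d) y.1 * (pol_annot Pol alpha y.2)%:~R
    <= (pol_annot Pol alpha s)%:~R :> R.
Proof.
move=> adp_a flat_dec annot_dec /(adp_step_pol_annot alpha adp_a).
move=> [beta [A [B [t [A0 -> s_ge tE]]]]].
apply: le_trans (_ : _ <= _%:~R) _; last by rewrite ler_int; exact: s_ge.
rewrite big_mset_map.
have [_ _ [_ sum1] _] := adp_a.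
rewrite (eq_big_seq (fun x => (x.1 * (pol_annot Pol beta x.2)%:~R) *+ ann +
    (A%:~R * (x.1 * (pol Pol beta (flat x.2))%:~R)) *+ flag a + x.1 * B%:~R)).
  rewrite !big_split /= !sumrMnl -mulr_sumr -mulr_suml sum1 mul1r.
  rewrite !rmorphD /= !rmorphMn /= rmorphM lerD2r; apply: lerD.
    by rewrite lerMn2r annot_dec orbT.
  have [/flat_dec flat_le|//] := boolP (flag a).
  by rewrite !mulr1n ler_wpM2l // ler0z.
move=> x xa /=; rewrite tE // !rmorphD /= !rmorphMn /= rmorphM.
by rewrite !mulrDr !mulrnAr mulrCA.
Qed.

Lemma step_pol_annot_lt P a s d alpha : is_adp a ->
  annot_strictly_decreasing a -> adp_step P a true s d ->
  exists x y, [/\ x \in rhs a, y \in d, y.1 = x.1 &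
    pol_annot Pol alpha y.2 < pol_annot Pol alpha s].
Proof.
move=> adp_a [x [xa annot_lt flat_le]] /(adp_step_pol_annot alpha adp_a).
move=> [beta [A [B [t [A0 -> s_ge tE]]]]].
exists x, (x.1, t x); split=> //=.
  by rewrite (perm_mem (perm_mset_map _ _)); apply/mapP; exists x.
apply: lt_le_trans s_ge; rewrite tE // ltrD2r; apply: ltr_leD.
  exact: annot_lt.
case: (flag a) flat_le => // /(_ erefl) flat_le.
by rewrite !mulr1n ler_wpM2l.
Qed.

End Decrease.

Section ReductionPairProcessor.
Context {S : signature} {X : Type} {R : realType}.
Variables Pge Pgt : set (adp S X R).
Local Notation P := (Pge `|` Pgt).
Local Notation P' := (Pge `|` [set flat_adp a | a in Pgt]).
Hypothesis P_problem : adp_problem P.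

Let P_adp a : P a -> is_adp a := P_problem.2 a.

Lemma left_sides_flatten : left_sides P' = left_sides P.
Proof.
rewrite /left_sides !image_setU image_comp; congr (_ `|` _).
by apply: eq_imagel => a Pa; apply: flat_adp_lhs; apply: P_adp; right.
Qed.

Lemma flatten_complete : iAST P -> iAST P'.
Proof.
apply: iAST_annot_le; first by rewrite left_sides_flatten.
move=> a [a_ge|[b b_gt <-]].
  by exists a; [left|apply: adp_annot_le_refl].
exists b; first by right.
by apply: flat_adp_annot_le; apply: P_adp; right.
Qed.

Variable Pol : polint S.
Hypothesis Pol_multilinear : multilinear Pol.
Hypothesis flat_weak : forall a, P a -> flat_weakly_decreasing Pol a.
Hypothesis annot_weak : forall a, P a -> annot_weakly_decreasing Pol a.
Hypothesis annot_strict : forall a, Pgt a -> annot_strictly_decreasing Pol a.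

Section ChainTree.
Variable T : @ltree S X R.
Hypothesis ctT : chain_tree P T.

Let ptT : prob_tree T := chain_tree_prob_tree P_adp ctT.

Definition strict_nodes : set (carrier T) :=
  [set v | nodesP v /\
     exists2 a, Pgt a & adp_step P a true (label v) (children_dist v)].

Definition annot_value (v : carrier T) : R :=
  (pol_annot Pol (fun=> 0%N) (label v))%:~R.

Lemma node_step_flatten (v : carrier T) :
  inner v -> ~ strict_nodes v -> node_step P' v.
Proof.
move=> iv not_strict; have /stepP[a Pa st] := chain_tree_step ctT iv.
have [a_ge|a_gt] := Pa; apply/stepP.
  by exists a; [left|apply: adp_step_sub st; rewrite left_sides_flatten].
exists (flat_adp a); first by right; exists a.
move: st; case: asboolP => [Pv st|_ st].
  by case: not_strict; split=> //; exists a.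
apply: adp_step_flat_adp; first exact: P_adp.
by apply: adp_step_sub st; rewrite left_sides_flatten.
Qed.

Lemma strict_stopped_escape0 (v : carrier T) :
  iAST P' -> escape (stopped_chain strict_nodes (tree_chain ptT)) v = 0.
Proof.
move=> astP'; have [_ _ [r rootT]] := ct_tree ctT.
have [nv|not_node] := pselect (nodes v); last first.
  rewrite -escape_harmonic avg_stopped avg_leaf ?if_same //.
  by case.
rewrite -(escape_stopped _ ptT nv rootT).
have := astP' _ (chain_tree_stopped ptT nv rootT ctT node_step_flatten).
rewrite (leaf_massE (prob_tree_stopped _ ptT nv rootT)
  (root_stopped _ ptT nv rootT)) /=.
rewrite divff ?mul1r ?gt_eqF ?(pt_gt0 ptT) // => -[].
lra.
Qed.

Lemma avg_annot_value (v : carrier T) :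
  avg (tree_chain ptT) annot_value v <= annot_value v.
Proof.
have [iv|/(avg_leaf ptT) ->] := pselect (inner v); last first.
  by rewrite ler0z pol_annot_ge0.
have /stepP[a Pa st] := chain_tree_step ctT iv.
rewrite [leLHS](_ : _ = \sum_(y <- children_dist v)
  y.1 * (pol_annot Pol (fun=> 0%N) y.2)%:~R); last by rewrite big_children_dist.
exact: (step_pol_annot_average Pol_multilinear _ (P_adp Pa) (flat_weak Pa)
  (annot_weak Pa) st).
Qed.

Lemma annot_value_drop (delta : R) (v : carrier T) :
  (forall a x, P a -> x \in rhs a -> delta <= x.1) -> strict_nodes v ->
  exists2 w, w \in succ (tree_chain ptT) v &
    delta <= trans (tree_chain ptT) v w /\ annot_value w + 1 <= annot_value v.
Proof.
move=> delta_le [_ [a a_gt st]].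
have Pa : P a by right.
have [x [y [xa y_child yx y_lt]]] := step_pol_annot_lt Pol_multilinear
  (fun=> 0%N) (P_adp Pa) (annot_strict a_gt) st.
move: y_child; rewrite (perm_mem (perm_eq_seq_mset _)) => /mapP[w vw yE].
exists w => //; split.
  by rewrite (le_trans (delta_le _ _ Pa xa)) // -yx yE.
by rewrite /annot_value -[1]/(1%:~R) -intrD ler_int lezD1; rewrite yE in y_lt.
Qed.

End ChainTree.

Lemma flatten_sound : iAST P' -> iAST P.
Proof.
move=> astP' T ctT; have [_ _ [r rootT]] := ct_tree ctT.
have ptT := chain_tree_prob_tree P_adp ctT.
have [delta delta0 delta_le] := adp_problem_min_prob P_problem.
rewrite (leaf_massE ptT rootT) (ct_root ctT rootT) mul1r.
rewrite (drift_escape0 (K := @strict_nodes T) (V := @annot_value T) delta0)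
  ?subr0 //.
- by move=> v; rewrite ler0z pol_annot_ge0.
- exact: avg_annot_value.
- by move=> v; apply: annot_value_drop.
- by move=> v; apply: strict_stopped_escape0.
Qed.

End ReductionPairProcessor.

Theorem theorem19 (S : signature) (X : Type) (R : realType)
    (P Pge Pgt : set (adp S X R)) (Pol : polint S) :
  adp_problem P ->
  weakly_monotonic Pol ->
  multilinear Pol ->
  P = Pge `|` Pgt ->
  Pge `&` Pgt = set0 ->
  Pgt !=set0 ->
  (forall a, P a -> flag a = true ->
     forall alpha : X -> nat,
       \sum_(x <- rhs a) x.1 * (pol Pol alpha (flat x.2))%:~R
         <= (pol Pol alpha (lhs a))%:~R :> R) ->
  (forall a, P a ->
     forall alpha : X -> nat,
       \sum_(x <- rhs a) x.1 * (pol_annot Pol alpha x.2)%:~R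
         <= (pol Pol alpha (sharp (lhs a)))%:~R :> R) ->
  (forall a, Pgt a ->
     exists x : R * term S X,
       [/\ x \in rhs a,
           forall alpha : X -> nat,
             pol_annot Pol alpha x.2 < pol Pol alpha (sharp (lhs a)) &
           flag a = true ->
             forall alpha : X -> nat,
               pol Pol alpha (flat x.2) <= pol Pol alpha (lhs a)]) ->
  (iAST P <-> iAST (Pge `|` [set flat_adp a | a in Pgt])).
Proof.
move=> P_problem _ Pol_multilinear PE _ _ flat_weak annot_weak annot_strict.
subst P; split; first exact: flatten_complete.
exact: flatten_sound Pol_multilinear flat_weak annot_weak annot_strict.
Qed.
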